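(* For every open neighborhood $U$ of the Mandelbrot set $\mathcal{M}$ in $\mathbb{C}$ there exists an integer $N$ such that for all $n>N$ and all $c\in\mathbb{C}\setminus U$, $M_n(-c/2)\neq0$.
   Context: The Mandelbrot set $\mathcal{M}$ is the set of $c\in\mathbb{C}$ for which the sequence $I_0=0$, $I_{k}=I_{k-1}^2+c$ is bounded. The Mandelbrot polynomials $M_n(y)\in\mathbb{Q}[y]$ are defined recursively by $M_1(y)=y$; $M_n(y)=-\frac12\sum_{i=1}^{n-1}M_i(y)M_{n-i}(y)$ for $n>1$ odd; and $M_n(y)=\frac12M_{n/2}(y)-\frac12\sum_{i=1}^{n-1}M_i(y)M_{n-i}(y)$ for $n>1$ even. *)

(* Defs.v *)
From mathcomp Require Import all_boot all_order all_algebra.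
From mathcomp Require Import all_classical all_reals all_analysis.
From mathcomp Require Import complex.

Set Implicit Arguments.
Unset Strict Implicit.
Unset Printing Implicit Defensive.

Import Order.TTheory GRing.Theory Num.Theory.
Import numFieldNormedType.Exports.

Local Open Scope classical_set_scope.
Local Open Scope ring_scope.

(* MathComp-Analysis equips the alias [R[i]^o], rather than [R[i]] itself,
   with the topology induced by the complex modulus. *)
Definition mandelbrot_orbit (R : realType) (c : R[i]) (k : nat) : R[i]^o :=
  iter k (fun z : R[i] => z ^+ 2 + c) 0.

Definition mandelbrot_set (R : realType) : set R[i]^o :=
  [set c | bounded_fun (mandelbrot_orbit c)].

Arguments mandelbrot_set R : clear implicits.

(* [fuel] only makes the strong recursion structural; any [fuel >= n] gives the
   same value.  The recursion is recovered in the three lemmas closing the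
   file; the index 0 is not used and gets the value 0. *)
Fixpoint mandelbrot_poly_rec (fuel n : nat) : {poly rat} :=
  if fuel is k.+1 then
    let M := mandelbrot_poly_rec k in
    if n == 1%N then 'X
    else if odd n then
      - (2^-1 *: \sum_(1 <= i < n) M i * M (n - i)%N)
    else
      2^-1 *: M n./2 - 2^-1 *: \sum_(1 <= i < n) M i * M (n - i)%N
  else 0.

Definition mandelbrot_poly (n : nat) : {poly rat} := mandelbrot_poly_rec n n.

Lemma mandelbrot_poly_rec_fuel (k n : nat) :
  (n <= k)%N -> mandelbrot_poly_rec k n = mandelbrot_poly n.
Proof.
suff H m : forall k1 k2 n1, (k1 <= m)%N -> (n1 <= k1)%N -> (n1 <= k2)%N ->
    mandelbrot_poly_rec k1 n1 = mandelbrot_poly_rec k2 n1.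
  by move=> nk; apply: (H k).
have rec0 k1 : mandelbrot_poly_rec k1 0 = 0.
  by elim: k1 => //= k1 ->; rewrite big_geq // !scaler0 subr0.
elim: m => [|m IH] [|k1] [|k2] [|n1] //; rewrite ?rec0 // => k1m n1k1 n1k2.
rewrite /=; case: eqP => // _.
have E : \sum_(1 <= i < n1.+1) mandelbrot_poly_rec k1 i *
           mandelbrot_poly_rec k1 (n1.+1 - i) =
         \sum_(1 <= i < n1.+1) mandelbrot_poly_rec k2 i *
           mandelbrot_poly_rec k2 (n1.+1 - i).
  apply: eq_big_nat => i /andP[i0 iln].
  have d : (n1.+1 - i <= n1)%N by rewrite -ltnS ltn_subrL i0.
  have ? : (i <= n1)%N by [].
  by congr (_ * _); apply: IH => //; apply: leq_trans; eauto.
rewrite E; case: ifP => // _; congr (_ *: _ - _).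
have d : (uphalf n1 <= n1)%N by rewrite leq_uphalf_double -addnn leq_addr.
by apply: IH => //; apply: leq_trans; eauto.
Qed.

Lemma mandelbrot_poly1 : mandelbrot_poly 1 = 'X.
Proof. by []. Qed.

Lemma mandelbrot_poly_odd (n : nat) : (1 < n)%N -> odd n ->
  mandelbrot_poly n =
    - (2^-1 *: \sum_(1 <= i < n) mandelbrot_poly i * mandelbrot_poly (n - i)%N).
Proof.
case: n => // n n_gt1 n_odd; rewrite {1}/mandelbrot_poly /=.
rewrite (gtn_eqF n_gt1) -[~~ odd n]/(odd n.+1) n_odd.
congr (- (_ *: _)); apply: eq_big_nat => i /andP[i0 iln].
by rewrite !mandelbrot_poly_rec_fuel // -ltnS ltn_subrL i0.
Qed.

Lemma mandelbrot_poly_even (n : nat) : (1 < n)%N -> ~~ odd n ->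
  mandelbrot_poly n =
    2^-1 *: mandelbrot_poly n./2 -
    2^-1 *: \sum_(1 <= i < n) mandelbrot_poly i * mandelbrot_poly (n - i)%N.
Proof.
case: n => // n n_gt1 /negbTE n_even; rewrite {1}/mandelbrot_poly /=.
rewrite (gtn_eqF n_gt1) -[~~ odd n]/(odd n.+1) n_even.
rewrite mandelbrot_poly_rec_fuel; last by rewrite leq_uphalf_double -addnn leq_addr.
congr (_ - _ *: _); apply: eq_big_nat => i /andP[i0 iln].
by rewrite !mandelbrot_poly_rec_fuel // -ltnS ltn_subrL i0.
Qed.

(* Main.v *)
Require Import Defs.
From mathcomp Require Import all_boot all_order all_algebra.
From mathcomp Require Import all_solvable all_field.
From mathcomp Require Import all_classical all_reals all_analysis.
From mathcomp Require Import complex ring lra.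

(* Put a_n = M_n(-c/2), a_0 = 1 and G(x) = sum_n a_n x^n.  The recursion says
   G(x)^2 = G(x^2) - c x, so psi(x) = G(x^2)/x satisfies
   psi(x^2) = psi(x)^2 + c: it is the inverse Boettcher map of z^2 + c at
   infinity, in the coordinate 1/x.  For c outside the Mandelbrot set the
   critical value c equals psi(t) for some t with |t| < 1, and t is the unique
   zero of G(x^2) - c x in a disk slightly larger than |x| <= |t|, and a simple
   one.  Hence G = sqrt(1 - x/t) * S with S analytic on a larger disk and
   S(t) <> 0, so that a_n t^n is asymptotic to S(t) times the n-th coefficient
   of sqrt(1 - x), which is not 0.

   To obtain this uniformly in c, suppose a_{n_k}(c_k) = 0 with n_k -> oo, and
   pass to limits along an ultrafilter on the indices k.  Either c_k converges
   to some c outside the Mandelbrot set, or |c_k| -> oo and the rescaling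
   w = c_k x turns G(x^2) - c_k x into a perturbation of 1 - w.  Only truncated
   power series occur, so all analytic functions are polynomials, and facts
   about limit functions are statements about polynomials that hold up to
   infinitesimals along the ultrafilter. *)

Set Implicit Arguments.
Unset Strict Implicit.
Unset Printing Implicit Defensive.

Import Order.TTheory GRing.Theory Num.Theory.
Import numFieldNormedType.Exports.

Local Open Scope classical_set_scope.
Local Open Scope ring_scope.

(** Zeros are produced without Rouché or Cauchy theory. A polynomial [p] with [p(0) = 1], [|p| <= B]
    and no zero on [|x| <= rho] has a formal square root whose [j]-th coefficient is at most
    [sqrt (2 B) / rho^j], whatever the degree of [p]. So if the coefficients of a square root
    violate this bound, [p] has a zero in the disk. For [t] the violation comes from maximality: if
    [R0 < 1] is the largest radius on which [G] is controlled, then [G(x^2) - c x] is controlled up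
    to [sqrt R0 > R0], and only a zero can stop [G] from being controlled beyond [R0]. That [R0 < 1]
    is where the escape of the critical orbit enters. Simplicity of the zero rests on
    [V = 2 x G' - G], for which [V(x^2) = x^2 psi'(x)]. Differentiating the functional equation
    gives [V(x^2) = G(x) V(x)], so a zero of [V] would propagate along repeated squares to 0, where
    [V = -1]. *)

Local Notation cmod := (@Normc.normc _).

(** * Power series estimates for polynomials *)

Section Modulus.
Variable R : realType.
Implicit Types x y z : R[i].

Lemma cmod0 : cmod (0 : R[i]) = 0.
Proof. exact: (@Normc.normc0 R). Qed.

Lemma cmod1 : cmod (1 : R[i]) = 1.
Proof. exact: (@Normc.normc1 R). Qed.

Lemma cmodM x y : cmod (x * y) = cmod x * cmod y.
Proof. exact: Normc.normcM. Qed.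

Lemma cmodV x : cmod x^-1 = (cmod x)^-1.
Proof. exact: Normc.normcV. Qed.

Lemma cmodN x : cmod (- x) = cmod x.
Proof. by case: x => a b; rewrite /= !sqrrN. Qed.

Lemma cmodX x n : cmod (x ^+ n) = cmod x ^+ n.
Proof. by elim: n => [|n IH]; rewrite ?expr0 ?cmod1 // !exprS cmodM IH. Qed.

Lemma normCE x : `|x| = (cmod x)%:C%C.
Proof. by case: x. Qed.

Lemma cmod_ge0 x : 0 <= cmod x.
Proof. by case: x => a b; exact: sqrtr_ge0. Qed.

Lemma cmod_eq0 x : (cmod x == 0) = (x == 0).
Proof. by apply/eqP/eqP => [/Normc.eq0_normc|->]; last exact: cmod0. Qed.

Lemma cmod_gt0 x : (0 < cmod x) = (x != 0).
Proof. by rewrite lt_def cmod_ge0 andbT cmod_eq0. Qed.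

Lemma ler_cmodD x y : cmod (x + y) <= cmod x + cmod y.
Proof. by have := ler_normD x y; rewrite !normCE -rmorphD lecR. Qed.

Lemma ler_cmodB x y : cmod (x - y) <= cmod x + cmod y.
Proof. by rewrite -(cmodN y) ler_cmodD. Qed.

Lemma lerB_cmod x y : cmod x - cmod y <= cmod (x - y).
Proof. by rewrite lerBlDr -{1}(subrK y x) ler_cmodD. Qed.

Lemma cmodBC x y : cmod (x - y) = cmod (y - x).
Proof. by rewrite -opprB cmodN. Qed.

Lemma ler_cmod_sum (I : Type) (r : seq I) (P : pred I) (F : I -> R[i]) :
  cmod (\sum_(i <- r | P i) F i) <= \sum_(i <- r | P i) cmod (F i).
Proof.
elim/big_ind2: _ => // [|x1 x2 y1 y2 h1 h2]; first by rewrite cmod0.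
by apply: le_trans (ler_cmodD _ _) _; exact: lerD.
Qed.

Lemma cmodR (a : R) : cmod (a%:C%C) = `|a|.
Proof. by rewrite /= expr0n addr0 sqrtr_sqr. Qed.

Lemma cmodn n : cmod (n%:R : R[i]) = n%:R.
Proof. by rewrite -(rmorph_nat (real_complex R)) cmodR normr_nat. Qed.

End Modulus.

Arguments Normc.normc : simpl never.

Section Geometric.
Variable R : realType.
Implicit Types q : R.

Lemma sum_geom_le q n : 0 <= q < 1 -> \sum_(i < n) q ^+ i <= (1 - q)^-1.
Proof.
move=> /andP[q0 q1]; have h : 0 < 1 - q by rewrite subr_gt0.
rewrite -[leRHS]mul1r ler_pdivlMr // mulrC.
by rewrite -opprB mulNr -subrX1 opprB gerBl exprn_ge0.
Qed.

(** Each of the [n + 1] terms of the geometric sum is at least [q^n]. This absorbs the linear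
    factors created by Cauchy products and by differentiation when the radius shrinks from [r] to
    [q * r]. *)
Lemma linear_geom_le q n : 0 <= q < 1 -> n.+1%:R * q ^+ n <= (1 - q)^-1.
Proof.
move=> q01; apply: le_trans (sum_geom_le n.+1 q01).
rewrite mulr_natl -[in leLHS](card_ord n.+1) -sumr_const.
case/andP: q01 => q0 q1; apply: ler_sum => i _.
by rewrite ler_wiXn2l // ?(ltW q1) // -ltnS ltn_ord.
Qed.

Lemma geom_small q e : 0 <= q < 1 -> 0 < e -> exists n, forall m, (n <= m)%N -> q ^+ m < e.
Proof.
move=> /andP[q0 q1] e0.
have : (fun n => q ^+ n) @ \oo --> (0 : R) by apply: cvg_expr; rewrite ger0_norm.
move=> /cvgrPdist_lt /(_ _ e0) [n _ H]; exists n => m nm.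
by have := H m nm; rewrite /= sub0r normrN ger0_norm // exprn_ge0.
Qed.

End Geometric.

Section CoefBound.
Variable R : realType.
Local Notation C := R[i].
Implicit Types (f g : {poly C}) (x : C) (r q B : R).

(** A Cauchy estimate used in place of a sup norm on the disk of radius [r]: it is inherited by
    truncations with the same constant, which a sup norm is not. *)
Definition coef_bound f r B := forall j, cmod f`_j * r ^+ j <= B.

Lemma coef_bound_ge0 f r B : coef_bound f r B -> 0 <= B.
Proof. by move/(_ 0%N); apply: le_trans; rewrite expr0 mulr1 cmod_ge0. Qed.

Lemma coef_boundW f r r' B B' : 0 <= r' <= r -> B <= B' ->
  coef_bound f r B -> coef_bound f r' B'.
Proof.
move=> /andP[r0 rr] BB h j; apply: le_trans BB; apply: le_trans (h j).
by rewrite ler_wpM2l ?cmod_ge0 // lerXn2r // nnegrE // (le_trans r0).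
Qed.

Lemma coef_boundD f g r B B' : 0 <= r ->
  coef_bound f r B -> coef_bound g r B' -> coef_bound (f + g) r (B + B').
Proof.
move=> r0 hf hg j; rewrite coefD; apply: le_trans (lerD (hf j) (hg j)).
by rewrite -mulrDl ler_wpM2r ?exprn_ge0 // ler_cmodD.
Qed.

Lemma coef_boundN f r B : coef_bound f r B -> coef_bound (- f) r B.
Proof. by move=> h j; rewrite coefN cmodN. Qed.

Lemma coef_boundB f g r B B' : 0 <= r ->
  coef_bound f r B -> coef_bound g r B' -> coef_bound (f - g) r (B + B').
Proof. by move=> r0 hf hg; apply: coef_boundD => //; exact: coef_boundN. Qed.

Lemma coef_boundM f g r q B B' : 0 <= r -> 0 <= q < 1 ->
  coef_bound f r B -> coef_bound g r B' -> coef_bound (f * g) (q * r) ((1 - q)^-1 * (B * B')).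
Proof.
move=> r0 q01 hf hg j; have B0 := coef_bound_ge0 hf; have B'0 := coef_bound_ge0 hg.
apply: le_trans (ler_wpM2r _ (linear_geom_le j q01)); last exact: mulr_ge0.
have -> : cmod (f * g)`_j * (q * r) ^+ j = q ^+ j * (cmod (f * g)`_j * r ^+ j).
  by rewrite exprMn mulrCA.
rewrite -mulrA [leRHS]mulrCA ler_wpM2l //; first by rewrite exprn_ge0 //; case/andP: q01.
rewrite coefM mulr_natl -[in leRHS](card_ord j.+1) -sumr_const.
apply: le_trans (_ : (\sum_(i < j.+1) cmod (f`_i * g`_(j - i))) * r ^+ j <= _).
  by rewrite ler_wpM2r ?exprn_ge0 // ler_cmod_sum.
rewrite mulr_suml; apply: ler_sum => i _.
have -> : r ^+ j = r ^+ i * r ^+ (j - i) by rewrite -exprD subnKC // -ltnS.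
by rewrite cmodM mulrACA ler_pM ?mulr_ge0 ?cmod_ge0 ?exprn_ge0.
Qed.

Lemma coef_bound_comp f r s B : 0 <= s -> s ^+ 2 <= r ->
  coef_bound f r B -> coef_bound (f \Po 'X^2) s B.
Proof.
move=> s0 sr h j; rewrite coef_comp_poly_Xn //.
case: dvdnP => [[k ->]|_]; last by rewrite cmod0 mul0r (coef_bound_ge0 h).
rewrite mulnK //; apply: le_trans (h k); rewrite mulnC exprM ler_wpM2l ?cmod_ge0 //.
by rewrite lerXn2r // nnegrE ?exprn_ge0 // (le_trans _ sr) // exprn_ge0.
Qed.

Lemma coef_bound_take f r B n : coef_bound f r B -> coef_bound (take_poly n f) r B.
Proof.
move=> h j; rewrite coef_take_poly; case: ifP => // _.
by rewrite cmod0 mul0r (coef_bound_ge0 h).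
Qed.

Lemma coefXderiv f j : ('X * f^`())`_j = f`_j *+ j.
Proof. by rewrite coefXM coef_deriv; case: j. Qed.

Lemma coef_boundXderiv f r q B : 0 <= r -> 0 <= q < 1 ->
  coef_bound f r B -> coef_bound ('X * f^`()) (q * r) ((1 - q)^-1 * B).
Proof.
move=> r0 q01 h j; have B0 := coef_bound_ge0 h.
apply: le_trans (ler_wpM2r B0 (linear_geom_le j q01)).
rewrite coefXderiv -(mulr_natl f`_j) cmodM cmodn exprMn.
have -> : j%:R * cmod f`_j * (q ^+ j * r ^+ j) = (j%:R * q ^+ j) * (cmod f`_j * r ^+ j) by ring.
apply: ler_pM => //; rewrite ?mulr_ge0 ?cmod_ge0 ?exprn_ge0 //; case/andP: q01 => // q0 _.
by rewrite ler_wpM2r ?exprn_ge0 // ler_nat.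
Qed.

Lemma coef_boundC (a : C) r : 0 <= r -> coef_bound a%:P r (cmod a).
Proof.
move=> r0 j; rewrite coefC; case: eqP => [->|_]; first by rewrite mulr1.
by rewrite cmod0 mul0r cmod_ge0.
Qed.

Lemma coef_boundZX (a : C) r : 0 <= r -> coef_bound (a *: 'X) r (cmod a * r).
Proof.
move=> r0 j; rewrite coefZ coefX; case: eqP => [->|_]; first by rewrite mulr1.
by rewrite mulr0 cmod0 mul0r mulr_ge0 ?cmod_ge0.
Qed.

Lemma horner_bound f x r q B : 0 < r -> 0 <= q < 1 ->
  coef_bound f r B -> cmod x <= q * r -> cmod f.[x] <= B * (1 - q)^-1.
Proof.
move=> r0 q01 h hx; have B0 := coef_bound_ge0 h; have [q0 q1] := andP q01.
rewrite horner_coef; apply: le_trans (ler_cmod_sum _ _ _) _.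
apply: le_trans (ler_wpM2l B0 (sum_geom_le (size f) q01)).
rewrite mulr_sumr; apply: ler_sum => i _; rewrite cmodM cmodX.
apply: le_trans (ler_wpM2r (exprn_ge0 i q0) (h i)); rewrite -mulrA ler_wpM2l ?cmod_ge0 //.
rewrite mulrC -exprMn lerXn2r // nnegrE ?cmod_ge0 //.
by rewrite mulr_ge0 // ltW.
Qed.

Lemma horner_bound_tail f x r q B m : 0 < r -> 0 <= q < 1 ->
  coef_bound f r B -> (forall j, (j < m)%N -> f`_j = 0) -> cmod x <= q * r ->
  cmod f.[x] <= B * (1 - q)^-1 * q ^+ m.
Proof.
move=> r0 q01 h f0 hx; have B0 := coef_bound_ge0 h; have [q0 q1] := andP q01.
have rm : 0 < r ^+ m by rewrite exprn_gt0.
have -> : f = drop_poly m f * 'X^m.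
  rewrite -[LHS](poly_take_drop m).
  suff -> : take_poly m f = 0 by rewrite add0r.
  by apply/polyP => j; rewrite coef_take_poly coef0; case: ifP => // /f0.
have hd : coef_bound (drop_poly m f) r (B / r ^+ m).
  by move=> j; rewrite coef_drop_poly ler_pdivlMr // -mulrA -exprD.
rewrite hornerM hornerXn cmodM cmodX.
apply: le_trans (_ : B / r ^+ m * (1 - q)^-1 * (q * r) ^+ m <= _); last first.
  rewrite exprMn le_eqVlt; apply/orP; left; apply/eqP.
  by field; rewrite subr_eq0 ?(gt_eqF r0) ?(gt_eqF rm) (gt_eqF q1).
apply: ler_pM; rewrite ?cmod_ge0 ?exprn_ge0 //; first exact: cmod_ge0.
  exact: horner_bound hd hx.
rewrite lerXn2r // nnegrE ?cmod_ge0 //.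
by rewrite mulr_ge0 // ltW.
Qed.

End CoefBound.

(** * Square roots of polynomials without zeros in a disk *)

Section Cauchy.
Variable R : realType.
Local Notation C := R[i].

Lemma ex_prim_root n : (0 < n)%N -> exists z : C, n.-primitive_root z.
Proof.
move=> n0; have [rs Drs] := closed_field_poly_normal ('X^n - 1 : {poly C}).
have mon : ('X^n - 1 : {poly C}) \is monic by rewrite monicXnsubC.
move: Drs; rewrite (monicP mon) scale1r => Drs.
have urs : uniq rs.
  by rewrite -separable_prod_XsubC -Drs separable_Xn_sub_1 // pnatr_eq0 -lt0n.
have srs : size rs = n.
  by apply: succn_inj; rewrite -(size_prod_XsubC rs id) -Drs size_XnsubC.
have ars : all n.-unity_root rs.
  by apply/allP => z; rewrite unity_rootE -root_prod_XsubC -Drs rootE !hornerE subr_eq0.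
have /hasP [z _ hz] : has n.-primitive_root rs by apply: has_prim_root; rewrite ?srs.
by exists z.
Qed.

(* Averaging over roots of unity of order exceeding the degree replaces the
   Cauchy integral formula. *)
Lemma cauchy_inequality (T : {poly C}) (rho B : R) : 0 < rho ->
  (forall x, cmod x = rho -> cmod T.[x] <= B) -> coef_bound T rho B.
Proof.
move=> rho0 hT j; pose M := (size T + j).+1.
have [z hz] := @ex_prim_root M isT.
have jM : (j <= M)%N by rewrite /M -addnS ltnW // ltn_addl.
have z1 : cmod z = 1.
  apply/eqP; rewrite -(@pexpr_eq1 _ _ M) ?cmod_ge0 // -cmodX.
  by rewrite (prim_expr_order hz) cmod1.
have avg i : (i < M)%N -> \sum_(l < M) (z ^+ (i + (M - j))) ^+ l =
    if i == j then M%:R else 0.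
  move=> iM; case: eqP => [->|/eqP ij].
    rewrite subnKC // (prim_expr_order hz).
    by rewrite (eq_bigr (fun=> 1)) => [|l _]; rewrite ?expr1n // sumr_const card_ord.
  set w := z ^+ _.
  have w1 : w != 1.
    rewrite /w -(prim_order_dvd hz); apply: contra ij => /dvdnP [k hk].
    (* Since [i + (M - j) < 2 M], the only multiples of [M] to exclude are 0, impossible because
       [j < M], and [M] itself, which would force [i = j]. *)
    have : (k < 2)%N.
      rewrite -(@ltn_pmul2r M) // -hk mul2n -addnn.
      by rewrite -addSn leq_add // leq_subr.
    case: k hk => [|[|//]].
      rewrite mul0n => /eqP; rewrite addn_eq0 => /andP[_].
      by rewrite subn_eq0 leqNgt /M ltnS leq_addl.
    by rewrite mul1n => hk _; rewrite -(eqn_add2r (M - j)) subnKC // hk.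
  have /eqP : (w - 1) * \sum_(l < M) w ^+ l = 0.
    by rewrite -subrX1 -exprM mulnC exprM (prim_expr_order hz) expr1n subrr.
  by rewrite mulf_eq0 subr_eq0 (negbTE w1) => /eqP.
have key : \sum_(l < M) T.[rho%:C%C * z ^+ l] * z ^+ (l * (M - j)) =
    M%:R * (T`_j * rho%:C%C ^+ j).
  have sT : (size T <= M)%N by rewrite /M leqW // leq_addr.
  transitivity (\sum_(i < M) T`_i * rho%:C%C ^+ i *
      \sum_(l < M) (z ^+ (i + (M - j))) ^+ l).
    under eq_bigr do rewrite (horner_coef_wide _ sT) mulr_suml.
    rewrite exchange_big; apply: eq_bigr => i _; rewrite mulr_sumr.
    apply: eq_bigr => l _; rewrite exprMn -!mulrA; congr (_ * (_ * _)).
    by rewrite -!exprM -exprD mulnDl [(i * l)%N]mulnC [(l * (M - j))%N]mulnC.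
  have jM' : (j < M)%N by rewrite /M ltnS leq_addl.
  rewrite (bigD1 (Ordinal jM')) //= avg // eqxx big1 ?addr0 1?mulrC // => i.
  by rewrite -val_eqE /= => /negbTE ij; rewrite avg // ij mulr0.
have M0 : 0 < M%:R :> R by rewrite ltr0n.
have rhoE : rho = cmod rho%:C%C by rewrite cmodR ger0_norm // ltW.
rewrite -(ler_pM2l M0) [in leLHS]rhoE -cmodX -cmodM -(cmodn _ M).
rewrite -cmodM -key; apply: le_trans (ler_cmod_sum _ _ _) _.
rewrite cmodn mulr_natl -[in leRHS](card_ord M) -sumr_const; apply: ler_sum => l _.
rewrite cmodM cmodX z1 expr1n mulr1; apply: hT.
by rewrite cmodM cmodX z1 expr1n mulr1 cmodR ger0_norm // ltW.
Qed.

End Cauchy.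

Section BinomialSqrt.
Variable R : realType.

(** Taylor coefficients of [sqrt (1 - x)], given by their successive ratios; nonvanishing, the bound
    1 and the asymptotics of ratios are read off this form. *)
Fixpoint sqrt_coef (n : nat) : R :=
  if n is m.+1 then sqrt_coef m * ((m%:R - 2^-1) / m.+1%:R) else 1.

Let conv n : R := \sum_(i < n.+1) sqrt_coef i * sqrt_coef (n - i).
Let wconv n : R := \sum_(i < n.+1) i%:R * (sqrt_coef i * sqrt_coef (n - i)).

(** The square [y] of the series satisfies [(1 - x) y' = - y], that is
    [(m + 1) y_(m+1) = (m - 1) y_m]; the factor [m - 1] kills everything from degree 2 on. The
    weighted sum [wconv] plays the derivative, and symmetry of the convolution gives
    [2 wconv m = m conv m]. *)
Lemma sqrt_coef_conv n :
  \sum_(i < n.+1) sqrt_coef i * sqrt_coef (n - i) = (n == 0%N)%:R - (n == 1%N)%:R.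
Proof.
rewrite -/(conv n).
have w2 m : 2 * wconv m = m%:R * conv m.
  have -> : m%:R * conv m = \sum_(i < m.+1) (i%:R + (m - i)%:R) * (sqrt_coef i * sqrt_coef (m
    - i)).
    rewrite mulr_sumr; apply: eq_bigr => i _; rewrite -natrD subnKC //.
    by rewrite -ltnS.
  under eq_bigr do rewrite mulrDl; rewrite big_split /= -/(wconv m) mulr_natl mulr2n.
  congr (_ + _); rewrite (reindex_inj rev_ord_inj) /=; apply: eq_bigr => i _.
  by rewrite subSS subKn -1?ltnS // [sqrt_coef i * _]mulrC.
have ws m : wconv m.+1 = wconv m - conv m / 2.
  rewrite /wconv big_ord_recl /= mul0r add0r mulr_suml -sumrB; apply: eq_bigr => i _.
  rewrite /bump /= add1n subSS /=.
  have i0 : (i.+1%:R : R) != 0 by rewrite pnatr_eq0.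
  by field.
have rec m : m.+1%:R * conv m.+1 = (m%:R - 1) * conv m.
  by rewrite -w2 ws mulrBr w2; field.
have c0 : conv 0 = 1 by rewrite /conv big_ord1 /= mulr1.
case: n => [|n]; first by rewrite c0 subr0.
case: n => [|n].
  by have := rec 0; rewrite c0 mul1r mulr1 => ->.
rewrite !subr0; elim: n => [|n IH].
  by apply/eqP; have /eqP := rec 1; rewrite subrr mul0r mulf_eq0 pnatr_eq0.
by apply/eqP; have /eqP := rec n.+2; rewrite IH mulr0 mulf_eq0 pnatr_eq0.
Qed.

Lemma sqrt_coef_neq0 n : sqrt_coef n != 0.
Proof.
elim: n => [|n IH] /=; first exact: oner_neq0.
rewrite !mulf_neq0 ?invr_neq0 ?pnatr_eq0 // subr_eq0.
apply/eqP => h; have /eqP : (2 * n)%:R = 1%:R :> R by rewrite natrM h mulfV ?pnatr_eq0.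
by rewrite eqr_nat mul2n => /eqP /(congr1 odd); rewrite odd_double.
Qed.

Lemma sqrt_coef_le1 n : `|sqrt_coef n| <= 1.
Proof.
elim: n => [|n IH] /=; first by rewrite normr1.
rewrite normrM mulr_ile1 // normrM normfV [`|n.+1%:R|]ger0_norm //.
rewrite ler_pdivrMr ?ltr0n // mul1r ler_norml -natr1.
by have n0 : 0 <= n%:R :> R by []; apply/andP; split; lra.
Qed.

End BinomialSqrt.

Section Truncation.
Variable A : idomainType.
Implicit Types f g h : {poly A}.

Definition eq_upto n f g := forall i, (i < n)%N -> f`_i = g`_i.

Lemma eq_upto_mul n f f' g g' :
  eq_upto n f f' -> eq_upto n g g' -> eq_upto n (f * g) (f' * g').
Proof.
move=> hf hg i ni; rewrite !coefM; apply: eq_bigr => j _.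
rewrite hf ?hg //; first by rewrite (leq_ltn_trans _ ni) // leq_subr.
by rewrite (leq_ltn_trans _ ni) // -ltnS.
Qed.

(** In [(f - g) * (f + g)] the second factor has constant coefficient 2, hence is invertible as a
    power series, so all low coefficients of [f - g] vanish. *)
Lemma eq_upto_sqrt n f g : 2%:R != 0 :> A -> f`_0 = 1 -> g`_0 = 1 ->
  eq_upto n (f * f) (g * g) -> eq_upto n f g.
Proof.
move=> nz2 f0 g0 h.
have ds i : (i < n)%N -> ((f - g) * (f + g))`_i = 0.
  by move=> /h; rewrite mulrC -subr_sqr !expr2 coefB => ->; rewrite subrr.
suff d0 i : (i < n)%N -> (f - g)`_i = 0.
  by move=> i /d0; rewrite coefB => /eqP; rewrite subr_eq0 => /eqP.
elim/ltn_ind: i => i IH ni; have := ds i ni.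
rewrite coefM big_ord_recr /= subnn big1 ?add0r => [|j _].
  by rewrite [(f + g)`_0]coefD f0 g0 => /eqP; rewrite mulf_eq0 (negbTE nz2) orbF => /eqP.
by rewrite IH ?mul0r // (ltn_trans _ ni).
Qed.

End Truncation.

Section ApproxSqrt.
Variable R : realType.
Local Notation C := R[i].
Implicit Types (p f g : {poly C}) (x a : C) (rho eta B : R).

Definition sqrt_trunc a n : {poly C} := \poly_(i < n) ((sqrt_coef R i)%:C%C * a ^+ i).

Lemma sqrt_truncM a n : eq_upto n (sqrt_trunc a n * sqrt_trunc a n) (1 - a *: 'X).
Proof.
move=> i im; rewrite coefM.
transitivity (a ^+ i * (\sum_(l < i.+1) sqrt_coef R l * sqrt_coef R (i - l))%:C%C).
  rewrite rmorph_sum mulr_sumr; apply: eq_bigr => l _.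
  have li : (l <= i)%N by rewrite -ltnS.
  rewrite !coef_poly (leq_ltn_trans li im) (leq_ltn_trans (leq_subr _ _) im).
  have -> : a ^+ i = a ^+ l * a ^+ (i - l) by rewrite -exprD subnKC.
  by rewrite rmorphM /=; ring.
rewrite sqrt_coef_conv coefB coefZ coef1 coefX rmorphB !rmorph_nat.
case: i im => [|[|i]] _;
by rewrite /= ?(mulr0n, mulr1n, oppr0, expr0, expr1, mulr1, mulr0, subr0, sub0r, mul1r, mulrN1).
Qed.

(** [T] is a long truncation of the binomial series. The absolute error becomes relative because
    [|1 - a x| >= 1 - |a| rho > 0] on the disk; relative errors can then be multiplied over the
    zeros of a polynomial. *)
Lemma approx_sqrt_linear a rho eta n : 0 < rho -> cmod a * rho < 1 -> 0 < eta ->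
  exists T : {poly C}, [/\ T`_0 = 1, eq_upto n (T * T) (1 - a *: 'X) &
    forall x, cmod x <= rho ->
      (1 - eta) * cmod (1 - a * x) <= cmod T.[x] ^+ 2 <= (1 + eta) * cmod (1 - a * x)].
Proof.
move=> rho0 q1 eta0; set q := cmod a * rho in q1.
have q0 : 0 <= q by rewrite mulr_ge0 ?cmod_ge0 // ltW.
(* As [q <= k^2], the series has coefficients bounded by 1 at radius [r = rho / k^2]. One factor [k]
   is spent on squaring the series, the other on the geometric tail at [|x| <= rho]. *)
pose k := (1 + q) / 2.
have k0 : 0 < k by rewrite /k; lra.
have k1 : k < 1 by rewrite /k; lra.
have kq : q <= k ^+ 2 by rewrite -subr_ge0 (_ : _ - _ = ((1 - q) / 2) ^+ 2) ?sqr_ge0 // /k;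
  field.
have k01 : 0 <= k < 1 by rewrite ltW.
pose r := rho / k ^+ 2.
have r0 : 0 < r by rewrite divr_gt0 // exprn_gt0.
have ar : cmod a * r <= 1 by rewrite mulrA ler_pdivrMr ?exprn_gt0 // mul1r.
pose U := sqrt_trunc a.
have bU m : coef_bound (U m) r 1.
  move=> j; rewrite coef_poly; case: ifP => _; last by rewrite cmod0 mul0r.
  rewrite cmodM cmodR cmodX -mulrA -exprMn mulr_ile1 ?sqrt_coef_le1 //.
    by rewrite exprn_ge0 // mulr_ge0 ?cmod_ge0 // ltW.
  by rewrite exprn_ile1 // mulr_ge0 ?cmod_ge0 // ltW.
have UU m : eq_upto m (U m * U m) (1 - a *: 'X) := @sqrt_truncM a m.
pose K := ((1 - k)^-1 + 2) * (1 - k)^-1.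
have K0 : 0 < K by rewrite mulr_gt0 ?addr_gt0 ?invr_gt0 ?subr_gt0.
have e0 : 0 < eta * (1 - q) / K.
  by apply: divr_gt0 => //; apply: mulr_gt0 => //; rewrite subr_gt0.
have [m0 hm0] := geom_small k01 e0.
pose m := (maxn m0 n).+1.
have hm : K * k ^+ m <= eta * (1 - q).
  by rewrite mulrC -ler_pdivlMr // ltW // hm0 // /m leqW // leq_maxl.
exists (U m); split.
- by rewrite coef_poly /= expr0 mulr1.
- by move=> i ni; apply: UU; rewrite (leq_trans ni) // /m leqW // leq_maxr.
move=> x hx.
have lb : 1 - q <= cmod (1 - a * x).
  apply: le_trans (lerB_cmod _ _); rewrite cmod1 lerD2l lerN2 cmodM.
  by rewrite ler_wpM2l ?cmod_ge0.
have kr0 : 0 < k * r by rewrite mulr_gt0.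
have bl : coef_bound (1 - a *: 'X) (k * r) 2.
  move=> j; rewrite coefB coef1 coefZ coefX; case: j => [|[|j]] /=.
  - by rewrite mulr0 subr0 cmod1 mulr1 ler1n.
  - rewrite mulr1 sub0r cmodN expr1 mulrCA (le_trans (_ : _ <= 1)) ?ler1n //.
    by apply: mulr_ile1 => //; rewrite ?(ltW k0) ?(ltW k1) // mulr_ge0 ?cmod_ge0 ?(ltW r0).
  - by rewrite mulr0 subr0 cmod0 mul0r.
have bd : coef_bound (U m * U m - (1 - a *: 'X)) (k * r) ((1 - k)^-1 + 2).
  apply: coef_boundB bl; first exact: ltW.
  by have := coef_boundM (ltW r0) k01 (bU m) (bU m); rewrite !mulr1.
have err : cmod (U m).[x] ^+ 2 - cmod (1 - a * x) <= eta * (1 - q) /\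
    cmod (1 - a * x) - cmod (U m).[x] ^+ 2 <= eta * (1 - q).
  have h : cmod (U m * U m - (1 - a *: 'X)).[x] <= eta * (1 - q).
    apply: le_trans (horner_bound_tail kr0 k01 bd (m := m) _ _) _ => //.
      by move=> j jm; rewrite coefB UU // subrr.
    by rewrite mulrA -expr2 /r mulrC divfK // expf_neq0 // gt_eqF.
  have -> : cmod (U m).[x] ^+ 2 = cmod (U m * U m).[x] by rewrite hornerM cmodM expr2.
  have e1 : (U m * U m - (1 - a *: 'X)).[x] = (U m * U m).[x] - (1 - a * x).
    by rewrite !hornerE.
  rewrite e1 in h; split; first exact: le_trans (lerB_cmod _ _) h.
  by apply: le_trans (lerB_cmod _ _) _; rewrite cmodBC.
have e2 : eta * (1 - q) <= eta * cmod (1 - a * x) by rewrite ler_pM2l.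
by case: err => e3 e4; apply/andP; split; nra.
Qed.

Lemma approx_sqrt_prod (rs : seq C) rho eta n : 0 < rho ->
  (forall r, r \in rs -> rho < cmod r) -> 0 < eta <= 1 ->
  let Q := \prod_(r <- rs) (1 - r^-1 *: 'X) in
  exists T : {poly C}, [/\ T`_0 = 1, eq_upto n (T * T) Q &
    forall x, cmod x <= rho ->
      (1 - eta) * cmod Q.[x] <= cmod T.[x] ^+ 2 <= (1 + eta) * cmod Q.[x]].
Proof.
move=> rho0; elim: rs eta => [|r rs IH] eta hrs /andP[eta0 eta1] Q; rewrite {}/Q.
  exists 1; rewrite big_nil; split => [||x _]; rewrite ?coef1 ?mulr1 //.
  by rewrite !hornerE cmod1 expr1n !mulr1 gerBl lerDl ltW.
have rr : rho < cmod r by apply: hrs; rewrite mem_head.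
have r0 : 0 < cmod r by apply: lt_trans rr.
have rq : cmod r^-1 * rho < 1 by rewrite cmodV mulrC ltr_pdivrMr ?mul1r.
(* For [eta <= 1] the products [(1 - eta / 3)^2] and [(1 + eta / 3)^2] stay between [1 - eta] and
   [1 + eta]. *)
have e3 : 0 < eta / 3 <= 1 by apply/andP; split; lra.
have [T1 [T10 T1T1 hT1]] := IH (eta / 3) (fun s hs => hrs s (mem_behead (s := r :: rs) hs)) e3.
have e30 : 0 < eta / 3 by case/andP: e3.
have [T2 [T20 T2T2 hT2]] := approx_sqrt_linear n rho0 rq e30.
exists (T2 * T1); rewrite big_cons; split.
- by rewrite coefM big_ord1 T10 T20 mulr1.
- by rewrite mulrACA; exact: eq_upto_mul.
move=> x hx; have /andP[l1 u1] := hT1 x hx; have /andP[l2 u2] := hT2 x hx.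
rewrite !hornerM !cmodM exprMn.
have -> : (1 - r^-1 *: 'X).[x] = 1 - r^-1 * x by rewrite !hornerE.
set q2 := cmod (1 - _) in l2 u2 *; set q1 := cmod _.[x] in l1 u1 *.
have q10 : 0 <= q1 := cmod_ge0 _; have q20 : 0 <= q2 := cmod_ge0 _.
have qq : 0 <= q2 * q1 by rewrite mulr_ge0.
apply/andP; split.
  apply: le_trans (ler_pM _ _ l2 l1); rewrite ?mulr_ge0 //; try lra.
  rewrite mulrACA ler_wpM2r //; nra.
apply: le_trans (ler_pM _ _ u2 u1) _; rewrite ?sqr_ge0 //.
by rewrite mulrACA ler_wpM2r //; nra.
Qed.

Lemma poly_prod_roots p : p`_0 = 1 ->
  exists2 rs : seq C, p = \prod_(r <- rs) (1 - r^-1 *: 'X) & forall r, r \in rs -> root p r.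
Proof.
move=> p0; have [rs Dp] := closed_field_poly_normal p.
have pn0 : p != 0 by apply: contra_eq_neq p0 => ->; rewrite coef0 eq_sym oner_neq0.
have rp r : r \in rs -> root p r.
  by move=> hr; rewrite Dp rootZ ?lead_coef_eq0 // root_prod_XsubC.
have rn0 r : r \in rs -> r != 0.
  move/rp; apply: contraTneq => ->; rewrite rootE horner_coef0 p0; exact: oner_neq0.
exists rs => //.
have e : \prod_(z <- rs) ('X - z%:P) = (\prod_(z <- rs) - z) *: \prod_(r <- rs) (1 - r^-1 *:
  'X).
  rewrite -scaler_prod big_seq [RHS]big_seq; apply: eq_bigr => z /rn0 z0.
  by rewrite scalerBr scalerA mulNr mulfV // scaleN1r opprK addrC scaleNr alg_polyC.
rewrite Dp e scalerA; set c := _ * _; suff -> : c = 1 by rewrite scale1r.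
have := p0; rewrite Dp e scalerA -/c coefZ -horner_coef0 horner_prod.
rewrite big1 ?mulr1 // => z _.
by rewrite hornerD hornerN hornerZ hornerX hornerC mulr0 subr0.
Qed.

(** Multiplying the approximate roots of the factors [1 - x / r] over the zeros [r], with total
    relative error 1/2, gives [|T|^2 <= 3 B / 2] on the disk; the Cauchy inequality turns this into
    coefficient bounds independent of the degree and number of zeros of [p]. *)
Lemma approx_sqrt p rho B n : 0 < rho -> p`_0 = 1 ->
  (forall x, cmod x <= rho -> ~~ root p x) ->
  (forall x, cmod x <= rho -> cmod p.[x] <= B) ->
  exists T : {poly C}, [/\ T`_0 = 1, eq_upto n (T * T) p,
    coef_bound T rho (Num.sqrt (2 * B)) &
    forall x, cmod x <= rho -> cmod p.[x] / 2 <= cmod T.[x] ^+ 2].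
Proof.
move=> rho0 p0 nr pB.
have [rs Dp hrs] := poly_prod_roots p0.
have rrs r : r \in rs -> rho < cmod r.
  by move=> hr; rewrite ltNge; apply: contraL (hrs r hr) => /nr.
have e01 : 0 < (2^-1 : R) <= 1 by apply/andP; split; lra.
have [T [T0 TT hT]] := approx_sqrt_prod n rho0 rrs e01; rewrite -Dp in TT hT.
exists T; split => // [|x /hT /andP[h _]]; last first.
  by rewrite (le_trans _ h) // mulrC ler_wpM2r ?cmod_ge0 //; lra.
apply: cauchy_inequality => // x hx; have {}hx : cmod x <= rho by rewrite hx.
have /andP[_ h] := hT x hx; have q0 := cmod_ge0 p.[x]; have qB := pB x hx.
rewrite -[leLHS]ger0_norm ?cmod_ge0 // -sqrtr_sqr ler_wsqrtr //.
by apply: le_trans h _; lra.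
Qed.

(** Since square roots with constant term 1 are unique, any [A] inherits the bound of the
    approximate root. Read contrapositively, this is the criterion for the existence of zeros. *)
Lemma sqrt_coef_estimate p (A : {poly C}) rho B n : 0 < rho -> p`_0 = 1 ->
  (forall x, cmod x <= rho -> ~~ root p x) ->
  (forall x, cmod x <= rho -> cmod p.[x] <= B) ->
  A`_0 = 1 -> eq_upto n (A * A) p ->
  forall j, (j < n)%N -> cmod A`_j * rho ^+ j <= Num.sqrt (2 * B).
Proof.
move=> rho0 p0 nr pB A0 AA j jn.
have [T [T0 TT bT _]] := approx_sqrt n rho0 p0 nr pB.
rewrite (@eq_upto_sqrt _ n A T) ?pnatr_eq0 // => i ni.
by rewrite AA // TT.
Qed.

End ApproxSqrt.

(** * Asymptotics of the coefficients at a simple zero *)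

Section SqrtCoefRatio.
Variable R : realType.

Lemma contraction_small (e : nat -> R) th : 0 <= th < 1 -> (forall n, 0 <= e n) ->
  (forall eta, 0 < eta -> exists n1, forall n, (n1 <= n)%N -> e n.+1 <= th * e n + eta) ->
  forall eps, 0 < eps -> exists n0, forall n, (n0 <= n)%N -> e n <= eps.
Proof.
move=> th01 e0 h eps eps0; have /andP[th0 th1] := th01.
have d0 : 0 < 1 - th by rewrite subr_gt0.
have [n1 hn1] := h (eps * (1 - th) / 2) (divr_gt0 (mulr_gt0 eps0 d0) (ltr0n _ 2)).
have bnd k : e (n1 + k)%N <= th ^+ k * e n1 + eps / 2.
  elim: k => [|k IH]; first by rewrite addn0 expr0 mul1r lerDl divr_ge0 // ltW.
  rewrite addnS; apply: le_trans (hn1 _ (leq_addr _ _)) _.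
  apply: le_trans (lerD (ler_wpM2l th0 IH) (lexx _)) _.
  by rewrite exprS le_eqVlt; apply/orP; left; apply/eqP; field.
have en1 : 0 < e n1 + 1 by rewrite ltr_wpDl.
have [k0 hk0] := geom_small th01 (divr_gt0 eps0 (mulr_gt0 en1 (ltr0n _ 2))).
exists (n1 + k0)%N => n hn; have n1n : (n1 <= n)%N by rewrite (leq_trans _ hn) // leq_addr.
rewrite -(subnKC n1n); apply: le_trans (bnd _) _.
have : th ^+ (n - n1) < eps / ((e n1 + 1) * 2) by apply: hk0; rewrite leq_subRL.
rewrite ltr_pdivlMr ?mulr_gt0 // => hh.
have := exprn_ge0 (n - n1) th0; have := e0 n1; nra.
Qed.

Lemma sqrt_coef_ratio_cvg (d : R) : 0 < d -> exists n1, forall n, (n1 <= n)%N ->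
  `|1 - sqrt_coef R n / sqrt_coef R n.+1| <= d.
Proof.
move=> d0; have [m hm] : exists m : nat, 3 / d <= m%:R.
  by exists (Num.bound (3 / d));  apply/ltW/archi_boundP; rewrite divr_ge0 // ltW.
exists m.+1 => n mn.
have s0 := sqrt_coef_neq0 R n; have s1 := sqrt_coef_neq0 R n.+1.
have n1 : m%:R + 1 <= n%:R :> R by rewrite natr1 ler_nat.
have m0 : 0 <= m%:R :> R by [].
have nh : n%:R - 2^-1 != 0 :> R by rewrite gt_eqF //; lra.
have n10 : n.+1%:R != 0 :> R by rewrite pnatr_eq0.
have -> : sqrt_coef R n / sqrt_coef R n.+1 = n.+1%:R / (n%:R - 2^-1).
  by rewrite [sqrt_coef R n.+1]/= invfM mulrA mulfV // mul1r invf_div.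
pose x : R := n%:R - 2^-1; have hx : m%:R + 2^-1 <= x by rewrite /x; lra.
have x0 : 0 < x by lra.
have -> : 1 - n.+1%:R / (n%:R - 2^-1) = - (3 / (2 * x)).
  have -> : n.+1%:R = x + 3 / 2 by rewrite -natr1 /x; lra.
  by rewrite -/x; field; rewrite (gt_eqF x0).
rewrite normrN ger0_norm; last by rewrite divr_ge0 // mulr_ge0 // ltW.
rewrite ler_pdivrMr ?mulr_gt0 //.
by move: hm; rewrite ler_pdivrMr //; nra.
Qed.

(** Each ratio tends to 1, but [sqrt_coef 0 / sqrt_coef n] is unbounded, so there is no direct
    domination. Instead the sum [e n] satisfies [e (n + 1) <= th (|r| e n + |1 - r| / (1 - th))]
    with [r] the ratio of consecutive coefficients, a contraction with vanishing error. *)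
Lemma sqrt_coef_ratio_sum (th : R) : 0 <= th < 1 -> forall eps : R, 0 < eps ->
  exists n0, forall n, (n0 <= n)%N ->
  \sum_(j < n.+1) `|1 - sqrt_coef R (n - j) / sqrt_coef R n| * th ^+ j <= eps.
Proof.
move=> th01; have /andP[th0 th1] := th01.
pose e n := \sum_(j < n.+1) `|1 - sqrt_coef R (n - j) / sqrt_coef R n| * th ^+ j.
have e0 n : 0 <= e n by apply: sumr_ge0 => j _; rewrite mulr_ge0 ?exprn_ge0.
have th2 : 0 <= (1 + th) / 2 < 1 by apply/andP; split; lra.
apply: (contraction_small th2 e0) => eta eta0.
have d0 : 0 < Num.min ((1 - th) / 2) (eta * (1 - th)).
  by rewrite lt_min !mulr_gt0 ?invr_gt0 ?subr_gt0.
have [n1 hn1] := sqrt_coef_ratio_cvg d0; exists n1 => n /hn1 {hn1}.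
rewrite le_min => /andP[].
set r := sqrt_coef R n / _ => h1 h2.
have step : e n.+1 <= th * (`|r| * e n + `|1 - r| * (1 - th)^-1).
  rewrite /e big_ord_recl subn0 mulfV ?sqrt_coef_neq0 // subrr normr0 mul0r add0r.
  apply: le_trans (_ : th * (`|r| * e n + `|1 - r| * \sum_(j < n.+1) th ^+ j) <= _); last first.
    by rewrite ler_wpM2l // lerD2l ler_wpM2l // sum_geom_le.
  rewrite /e !mulr_sumr -big_split /= mulr_sumr; apply: ler_sum => j _.
  rewrite /bump /= add1n subSS exprS.
  have -> : sqrt_coef R (n - j) / (sqrt_coef R n * ((n%:R - 2^-1) / n.+1%:R)) =
      r * (sqrt_coef R (n - j) / sqrt_coef R n).
    rewrite -/(sqrt_coef R n.+1) /r; have sn := sqrt_coef_neq0 R n.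
    by have sn1 := sqrt_coef_neq0 R n.+1; field; rewrite sn sn1.
  rewrite mulrCA ler_wpM2l // [X in _ <= X + _]mulrA -mulrDl ler_wpM2r ?exprn_ge0 // -normrM.
  by rewrite mulrBr mulr1 -[X in `|X|](subrKA r) addrC ler_normD.
have r1 : `|r| <= 1 + (1 - th) / 2.
  by rewrite -[r](subKr 1) (le_trans (ler_normB _ _)) // normr1 lerD2l.
have h3 : `|1 - r| * (1 - th)^-1 <= eta by rewrite ler_pdivrMr // subr_gt0.
apply: le_trans step _; have := e0 n; have : 0 <= `|1 - r| * (1 - th)^-1.
  by rewrite mulr_ge0 // invr_ge0 subr_ge0 ltW.
set v := _ * _^-1 in h3 *; move: (e n) => E v0 E0.
have : th * (`|r| * E) <= (1 + th) / 2 * E.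
  rewrite mulrA ler_wpM2r //; have := normr_ge0 r; nra.
have : th * v <= eta by nra.
lra.
Qed.

End SqrtCoefRatio.

Section SimpleRoot.
Variable R : realType.
Local Notation C := R[i].

(* [A] agrees with [sqrt (1 - x/t) * T] up to order [n], where [T] approximates
   [sqrt Q]; hence [A_n t^n / sqrt_coef n] is close to [T t], which is bounded
   away from 0. *)
Lemma coef_neq0_simple_root (th rho B delta : R) : 0 < rho -> 0 <= th < 1 -> 0 < delta ->
  exists n0, forall n, (n0 <= n)%N -> forall (Q A : {poly C}) (t : C),
    Q`_0 = 1 ->
    (forall x, cmod x <= rho -> ~~ root Q x) ->
    (forall x, cmod x <= rho -> cmod Q.[x] <= B) ->
    t != 0 -> cmod t <= th * rho -> delta <= cmod Q.[t] ->
    A`_0 = 1 -> eq_upto n.+1 (A * A) ((1 - t^-1 *: 'X) * Q) ->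
    A`_n != 0.
Proof.
move=> rho0 th01 delta0; have /andP[th0 th1] := th01.
(* [K] bounds the coefficients of [T], and [d] is a lower bound for [|T(t)|], as
   [|T(t)|^2 >= |Q(t)| / 2 >= d^2]. If [A_n = 0], head and tail of [T(t)] will each be at most
   [d / 4], a contradiction. *)
pose K := Num.sqrt (2 * B) + 1; pose d := Num.sqrt (delta / 2).
have K0 : 0 < K by rewrite ltr_wpDl ?sqrtr_ge0.
have d0 : 0 < d by rewrite sqrtr_gt0 divr_gt0.
have eps0 : 0 < d / (4 * K) by rewrite divr_gt0 ?mulr_gt0.
have [n1 hn1] := sqrt_coef_ratio_sum th01 eps0.
have eps1 : 0 < d / (4 * K) * (1 - th) by rewrite mulr_gt0 ?subr_gt0.
have [n2 hn2] := geom_small th01 eps1.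
exists (maxn n1 n2) => n; rewrite geq_max => /andP[/hn1 {}hn1 n2n] Q A t.
move=> Q0 nrQ bQ t0 tth Qt A0 AA; apply/eqP => An0.
have {}hn2 : th ^+ n.+1 <= d / (4 * K) * (1 - th) by apply/ltW/hn2; rewrite leqW.
have trho : cmod t <= rho by rewrite (le_trans tth) // ler_piMl // ltW.
have [T [T0 TT bT hT]] := approx_sqrt n.+1 rho0 Q0 nrQ bQ.
have {}bT : coef_bound T rho K.
  by apply: coef_boundW bT; rewrite ?lexx ?(ltW rho0) // /K lerDl.
pose U := sqrt_trunc t^-1 n.+1.
have AE : eq_upto n.+1 A (U * T).
  apply: eq_upto_sqrt; rewrite ?pnatr_eq0 //.
    by rewrite coefM big_ord1 T0 mulr1 coef_poly /= expr0 mulr1.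
  move=> i ni; rewrite AA // mulrACA; symmetry; apply: eq_upto_mul ni => //.
  exact: sqrt_truncM.
pose s j := (sqrt_coef R j)%:C%C.
have s0 : s n != 0 by rewrite fmorph_eq0 sqrt_coef_neq0.
(* The vanishing of [A_n], divided by the [n]-th coefficient of [sqrt (1 - x/t)]. Without the
   ratios, all close to 1 for small [j], this would be the truncation of [T(t)]. *)
have sum0 : \sum_(j < n.+1) s (n - j)%N / s n * (T`_j * t ^+ j) = 0.
  have z : t ^+ n / s n * A`_n = 0 by rewrite An0 mulr0.
  rewrite -[RHS]z AE // coefMr mulr_sumr; apply: eq_bigr => j _.
  have jn : (j <= n)%N by rewrite -ltnS.
  rewrite coef_poly ltnS leq_subr -/(s _) exprVn.
  have -> : t ^+ n = t ^+ (n - j) * t ^+ j by rewrite -exprD subnK.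
  by field; rewrite s0 expf_neq0.
have head : cmod (take_poly n.+1 T).[t] <= d / 4.
  have -> : (take_poly n.+1 T).[t] = \sum_(j < n.+1) (1 - s (n - j)%N / s n) * (T`_j * t ^+ j).
    under eq_bigr do rewrite mulrBl mul1r.
    by rewrite sumrB sum0 subr0 horner_poly.
  apply: le_trans (ler_cmod_sum _ _ _) _.
  apply: le_trans (_ : K * (d / (4 * K)) <= _); last first.
    by rewrite le_eqVlt; apply/orP; left; apply/eqP; field; rewrite gt_eqF.
  apply: le_trans (ler_wpM2l (ltW K0) hn1); rewrite mulr_sumr; apply: ler_sum => j _.
  have -> : 1 - s (n - j)%N / s n = (1 - sqrt_coef R (n - j) / sqrt_coef R n)%:C%C.
    by rewrite rmorphB rmorph1 fmorph_div.
  rewrite cmodM cmodR mulrCA ler_wpM2l //.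
  rewrite cmodM cmodX; apply: le_trans (ler_wpM2r (exprn_ge0 j th0) (bT j)).
  rewrite -mulrA ler_wpM2l ?cmod_ge0 // -exprMn mulrC lerXn2r // nnegrE ?cmod_ge0 //.
  by rewrite mulr_ge0 // ltW.
have tail : cmod (T - take_poly n.+1 T).[t] <= d / 4.
  have bd : coef_bound (T - take_poly n.+1 T) rho K.
    move=> j; rewrite coefB coef_take_poly; case: ifP => _; last by rewrite subr0.
    by rewrite subrr cmod0 mul0r ltW.
  apply: le_trans (horner_bound_tail rho0 th01 bd (m := n.+1) _ tth) _.
    by move=> j jn; rewrite coefB coef_take_poly jn subrr.
  apply: le_trans (_ : K * (1 - th)^-1 * (d / (4 * K) * (1 - th)) <= _).
    by rewrite ler_wpM2l // mulr_ge0 ?(ltW K0) // invr_ge0 subr_ge0 ltW.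
  rewrite le_eqVlt; apply/orP; left; apply/eqP; field.
  by rewrite (gt_eqF K0) subr_eq0 (gt_eqF th1).
have Tt : cmod T.[t] <= d / 2.
  rewrite -[T](subrK (take_poly n.+1 T)) hornerD.
  by apply: le_trans (ler_cmodD _ _) _; lra.
have := hT t trho; rewrite leNgt => /negP; apply.
apply: le_lt_trans (_ : (d / 2) ^+ 2 < _).
  by rewrite lerXn2r // nnegrE ?cmod_ge0 // divr_ge0 // ltW.
rewrite exprMn sqr_sqrtr ?divr_ge0 ?(ltW delta0) //.
have : 0 < (delta / 2) by rewrite divr_gt0.
by move: Qt; rewrite expr2; lra.
Qed.

End SimpleRoot.

(** * Limits along an ultrafilter *)

Section Infinitesimals.
Variables (R : realType) (F : set_system nat).
Hypothesis FU : UltraFilter F.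
Local Notation C := R[i].
Implicit Types (z w x y : nat -> C) (f g : nat -> {poly C}) (A : nat -> Prop).

Let PF : ProperFilter F. Proof. exact: ultra_proper. Qed.
Local Existing Instance PF.

Definition infsm z := forall e : R, 0 < e -> \forall k \near F, cmod (z k) < e.

Definition bounded_along z := exists B : R, \forall k \near F, cmod (z k) <= B.

Lemma near_all A : (forall k, A k) -> \forall k \near F, A k.
Proof. exact: nearW. Qed.

Lemma near_or_near_not A : (\forall k \near F, A k) \/ (\forall k \near F, ~ A k).
Proof. exact: in_ultra_setVsetC. Qed.

Lemma near_contra A : ((\forall k \near F, ~ A k) -> False) -> \forall k \near F, A k.
Proof. by case: (near_or_near_not A). Qed.

Lemma infsm_eq z w : (\forall k \near F, z k = w k) -> infsm z -> infsm w.
Proof. by move=> zw hz e /hz; apply: filterS2 zw => k ->. Qed.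

Lemma infsm0 : infsm (fun=> 0).
Proof. by move=> e e0; apply: nearW => k; rewrite cmod0. Qed.

Lemma infsm_cst (c : C) : infsm (fun=> c) -> c = 0.
Proof.
move=> h; apply/eqP; rewrite -cmod_eq0; apply/eqP/le_anti; rewrite cmod_ge0 andbT.
apply/ler_addgt0Pl => e e0; rewrite addr0.
by have /filter_ex [_ /ltW] := h e e0.
Qed.

Lemma infsmN z : infsm z -> infsm (fun k => - z k).
Proof. by move=> hz e /hz; apply: filterS => k; rewrite cmodN. Qed.

Lemma infsmD z w : infsm z -> infsm w -> infsm (fun k => z k + w k).
Proof.
move=> hz hw e e0; have e2 : 0 < e / 2 by rewrite divr_gt0.
apply: filterS2 (hz _ e2) (hw _ e2) => k h1 h2.
by rewrite (le_lt_trans (ler_cmodD _ _)) // [ltRHS]splitr ltrD.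
Qed.

Lemma infsmB z w : infsm z -> infsm w -> infsm (fun k => z k - w k).
Proof. by move=> hz hw; apply: infsmD => //; exact: infsmN. Qed.

Lemma infsmMl z w : bounded_along z -> infsm w -> infsm (fun k => z k * w k).
Proof.
move=> [B hB] hw e e0; have B1 : 0 < `|B| + 1 by rewrite ltr_wpDl.
apply: filterS2 hB (hw _ (divr_gt0 e0 B1)) => k h1.
rewrite ltr_pdivlMr // cmodM => h2; apply: le_lt_trans h2.
rewrite mulrC ler_wpM2l ?cmod_ge0 // (le_trans h1) //.
by rewrite (le_trans (ler_norm _)) // lerDl.
Qed.

Lemma infsm_sqr z : infsm (fun k => z k ^+ 2) -> infsm z.
Proof.
move=> h e e0; apply: filterS (h _ (exprn_gt0 2 e0)) => k; rewrite cmodX.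
by rewrite ltr_pXn2r ?nnegrE ?cmod_ge0 ?(ltW e0).
Qed.

(** The ultrafilter property turns failure to be infinitesimal, a priori only a frequent event, into
    a lower bound valid near [F]. *)
Lemma not_infsm z : ~ infsm z -> exists2 d : R, 0 < d & \forall k \near F, d <= cmod (z k).
Proof.
move=> /existsNP [d /not_implyP [d0 h]]; exists d => //.
by have [//|] := near_or_near_not (fun k => cmod (z k) < d); apply: filterS => k /negP;
  rewrite -leNgt.
Qed.

Lemma infsm_mul_or z w : infsm (fun k => z k * w k) -> infsm z \/ infsm w.
Proof.
move=> h; have [|/not_infsm [d d0 hd]] := pselect (infsm z); first by left.
right=> e e0; apply: filterS2 hd (h _ (mulr_gt0 d0 e0)) => k h1; rewrite cmodM => h2.
by rewrite -(ltr_pM2l d0) (le_lt_trans _ h2) // ler_wpM2r ?cmod_ge0.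
Qed.

Lemma infsm_bounded z : infsm z -> bounded_along z.
Proof. by move=> /(_ 1 ltr01) h; exists 1; apply: filterS h => k /ltW. Qed.

Lemma bounded_cst (c : C) : bounded_along (fun=> c).
Proof. by exists (cmod c); apply: nearW. Qed.

Lemma bounded_alongD z w : bounded_along z -> bounded_along w ->
  bounded_along (fun k => z k + w k).
Proof.
move=> [B hB] [B' hB']; exists (B + B'); apply: filterS2 hB hB' => k h h'.
by rewrite (le_trans (ler_cmodD _ _)) // lerD.
Qed.

(** The limit is the supremum of the eventual lower bounds: a number above it is not an eventual
    lower bound, so by the ultrafilter property it is an eventual strict upper bound. *)
Lemma real_lim (a : nat -> R) (B : R) : (\forall k \near F, `|a k| <= B) ->
  exists l, forall e, 0 < e -> \forall k \near F, `|a k - l| < e.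
Proof.
move=> hB; pose S := [set b : R | \forall k \near F, b <= a k].
have supS : has_sup S.
  split.
    exists (- B); apply: filterS hB => k; rewrite ler_norml => /andP[-> //].
  exists B => b hb; have /filter_ex [k [h1 h2]] : F ([set k | `|a k| <= B] `&` [set k | b <=
    a k]).
    exact: filterI.
  by rewrite (le_trans h2) // (le_trans (ler_norm _)).
exists (sup S) => e e0.
have [b hb be] := sup_adherent e0 supS.
have [h|h] := near_or_near_not (fun k => sup S + e / 2 <= a k).
  have : sup S + e / 2 <= sup S by apply: ub_le_sup => //; case: supS.
  by rewrite gerDl leNgt divr_gt0.
apply: filterS2 hb h => k h1 /negP; rewrite -ltNge => h2.
by rewrite ltr_norml; apply/andP; split; lra.
Qed.

Lemma cmod_le_ReIm (z : C) : cmod z <= `|complex.Re z| + `|complex.Im z|.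
Proof.
case: z => a b /=; rewrite /Normc.normc -[leRHS]ger0_norm ?addr_ge0 // -sqrtr_sqr ler_wsqrtr //.
rewrite sqrrD !real_normK ?num_real // [leRHS]addrAC lerDl mulrn_wge0 // mulr_ge0.
Qed.

Lemma ReIm_le_cmod (z : C) : `|complex.Re z| <= cmod z /\ `|complex.Im z| <= cmod z.
Proof.
case: z => a b /=; rewrite /Normc.normc -!sqrtr_sqr.
by split; rewrite ler_wsqrtr // ?lerDl ?lerDr sqr_ge0.
Qed.

Lemma bounded_lim z : bounded_along z -> exists l, infsm (fun k => z k - l).
Proof.
move=> [B hB].
have [a ha] : exists a, forall e, 0 < e -> \forall k \near F, `|complex.Re (z k) - a| < e.
  apply: (real_lim (B := B)); apply: filterS hB => k; apply: le_trans.
  by have [] := ReIm_le_cmod (z k).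
have [b hb] : exists b, forall e, 0 < e -> \forall k \near F, `|complex.Im (z k) - b| < e.
  apply: (real_lim (B := B)); apply: filterS hB => k; apply: le_trans.
  by have [] := ReIm_le_cmod (z k).
exists (a +i* b)%C => e e0; have e2 : 0 < e / 2 by rewrite divr_gt0.
apply: filterS2 (ha _ e2) (hb _ e2) => k.
move=> h1 h2; apply: le_lt_trans (cmod_le_ReIm _) _.
have -> : complex.Re (z k - (a +i* b)%C) = complex.Re (z k) - a by case: (z k).
have -> : complex.Im (z k - (a +i* b)%C) = complex.Im (z k) - b by case: (z k).
by rewrite [ltRHS](splitr e) ltrD.
Qed.

Lemma lim_bound z l (B : R) : infsm (fun k => z k - l) ->
  (\forall k \near F, cmod (z k) <= B) -> cmod l <= B.
Proof.
move=> hl hB; apply/ler_addgt0Pl => e e0.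
have /filter_ex [k [h1 h2]] : F ([set k | cmod (z k) <= B] `&` [set k | cmod (z k - l) < e]).
  by apply: filterI => //; exact: hl.
have := ler_cmodB (z k) (z k - l); rewrite subKr => /le_trans; apply.
by rewrite addrC lerD // ltW.
Qed.

Definition bounded_family f (r : R) := exists B, \forall k \near F, coef_bound (f k) r B.

(** Dominated convergence, needed because the number [m k] of terms may grow without bound. *)
Lemma tannery (u : nat -> nat -> C) (m : nat -> nat) (B q : R) : 0 <= q < 1 ->
  (\forall k \near F, forall i, cmod (u k i) <= B * q ^+ i) ->
  (forall i, infsm (fun k => u k i)) ->
  infsm (fun k => \sum_(i < m k) u k i).
Proof.
move=> q01 dom u0 e e0; have /andP[q0 q1] := q01.
have e2 : 0 < e / 2 by rewrite divr_gt0.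
have B1 : 0 < `|B| + 1 by rewrite ltr_wpDl.
have d0 : 0 < e / 2 * (1 - q) / (`|B| + 1) by rewrite divr_gt0 // mulr_gt0 // subr_gt0.
have [J hJ] := geom_small q01 d0.
have head n d : 0 < d -> \forall k \near F, \sum_(i < n) cmod (u k i) < d.
  elim: n d => [|n IH] d dd; first by apply: nearW => k; rewrite big_ord0.
  have d2 : 0 < d / 2 by rewrite divr_gt0.
  apply: filterS2 (IH _ d2) (u0 n _ d2) => k h1 h2.
  by rewrite big_ord_recr /= [ltRHS]splitr ltrD.
apply: filterS2 dom (head J _ e2) => k hk hJk.
apply: le_lt_trans (ler_cmod_sum _ _ _) _.
have tail n : \sum_(i < n) cmod (u k (J + i)%N) <= e / 2.
  apply: le_trans (_ : \sum_(i < n) ((`|B| + 1) * q ^+ J) * q ^+ i <= _).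
    apply: ler_sum => i _; apply: le_trans (hk _) _.
    rewrite -mulrA -exprD ler_wpM2r ?exprn_ge0 //.
    by rewrite (le_trans (ler_norm _)) // lerDl.
  rewrite -mulr_sumr; apply: le_trans (ler_wpM2l _ (sum_geom_le n q01)) _.
    by rewrite mulr_ge0 ?exprn_ge0 // ltW.
  rewrite ler_pdivrMr ?subr_gt0 //.
  by have := ltW (hJ J (leqnn _)); rewrite ler_pdivlMr // mulrC.
have [mJ|Jm] := leqP (m k) J.
  apply: le_lt_trans (_ : \sum_(i < J) cmod (u k i) < e); last first.
    by rewrite (lt_trans hJk) // ltr_pdivrMr // ltr_pMr // ltr1n.
  rewrite (big_ord_widen _ (fun i => cmod (u k i)) mJ) big_mkcond /=.
  by apply: ler_sum => i _; case: ifP => // _; exact: cmod_ge0.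
rewrite -(subnKC (ltnW Jm)) big_split_ord /= [ltRHS]splitr.
by have := tail (m k - J)%N; lra.
Qed.

(** This replaces normal families: an identity of power series that holds coefficientwise in the
    limit holds at points of a strictly smaller disk. *)
Lemma horner_infsm f x (r s : R) : 0 <= s < r -> bounded_family f r ->
  (\forall k \near F, cmod (x k) <= s) ->
  (forall j, infsm (fun k => (f k)`_j)) -> infsm (fun k => (f k).[x k]).
Proof.
move=> /andP[s0 sr] [B hB] hx hf; have r0 : 0 < r by apply: le_lt_trans sr.
have q01 : 0 <= s / r < 1 by rewrite divr_ge0 ?(ltW r0) //= ltr_pdivrMr // mul1r.
apply: infsm_eq (tannery (fun k => size (f k)) (u := fun k i =>
  (f k)`_i * x k ^+ i) q01 (B := B) _ _).
- by apply: nearW => k; rewrite horner_coef.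
- apply: filterS2 hB hx => k h1 h2 i.
  rewrite cmodM cmodX expr_div_n mulrA -[leRHS]mulrAC.
  by apply: ler_pM; rewrite ?cmod_ge0 ?exprn_ge0 ?cmod_ge0 ?ler_pdivlMr ?exprn_gt0 // lerXn2r
    // nnegrE cmod_ge0.
- move=> i; apply: infsm_eq (infsmMl (z := fun k => x k ^+ i) _ (hf i)).
    by apply: nearW => k; rewrite mulrC.
  exists (s ^+ i); apply: filterS hx => k h; rewrite cmodX.
  by rewrite lerXn2r // nnegrE cmod_ge0.
Qed.

Lemma horner_equicontinuous f x y (r s : R) : 0 <= s < r -> bounded_family f r ->
  (\forall k \near F, cmod (x k) <= s) -> (\forall k \near F, cmod (y k) <= s) ->
  infsm (fun k => x k - y k) -> infsm (fun k => (f k).[x k] - (f k).[y k]).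
Proof.
move=> /andP[s0 sr] [B hB] hx hy xy; have r0 : 0 < r by apply: le_lt_trans sr.
have q01 : 0 <= s / r < 1 by rewrite divr_ge0 ?(ltW r0) //= ltr_pdivrMr // mul1r.
have pw i : infsm (fun k => x k ^+ i - y k ^+ i).
  apply: infsm_eq (infsmMl (z := fun k => \sum_(j < i) x k ^+ (i.-1 - j) * y k ^+ j) _ xy).
    by apply: nearW => k; rewrite subrXX mulrC.
  exists (\sum_(j < i) s ^+ (i.-1 - j) * s ^+ j); apply: filterS2 hx hy => k h1 h2.
  apply: le_trans (ler_cmod_sum _ _ _) _; apply: ler_sum => j _.
  rewrite cmodM !cmodX; apply: ler_pM; rewrite ?exprn_ge0 ?cmod_ge0 // lerXn2r // nnegrE
    ?cmod_ge0 //.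
apply: infsm_eq (tannery (fun k => size (f k)) (u := fun k i =>
  (f k)`_i * (x k ^+ i - y k ^+ i)) q01 (B := 2 * B) _ _).
- apply: nearW => k; rewrite !horner_coef -sumrB; apply: eq_bigr => i _.
  by rewrite mulrBr.
- apply: filterS3 hB hx hy => k h1 h2 h3 i.
  have h4 : cmod (x k ^+ i - y k ^+ i) <= 2 * s ^+ i.
    rewrite (le_trans (ler_cmodB _ _)) // !cmodX mulr_natl mulr2n.
    by apply: lerD; rewrite lerXn2r // nnegrE cmod_ge0.
  rewrite cmodM; apply: le_trans (ler_wpM2l (cmod_ge0 _) h4) _.
  rewrite mulrCA -mulrA ler_pM2l // expr_div_n mulrA mulrAC ler_wpM2r ?exprn_ge0 //.
  by rewrite ler_pdivlMr ?exprn_gt0.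
- move=> i; have [B' hB'] : bounded_along (fun k => (f k)`_i).
    exists (B / r ^+ i); apply: filterS hB => k h.
    by rewrite ler_pdivlMr ?exprn_gt0.
  by apply: infsmMl (pw i); exists B'.
Qed.

Lemma horner_bounded f x (r s : R) : 0 <= s < r -> bounded_family f r ->
  (\forall k \near F, cmod (x k) <= s) -> bounded_along (fun k => (f k).[x k]).
Proof.
move=> /andP[s0 sr] [B hB] hx; have r0 : 0 < r by apply: le_lt_trans sr.
have q01 : 0 <= s / r < 1 by rewrite divr_ge0 ?(ltW r0) //= ltr_pdivrMr // mul1r.
exists (B * (1 - s / r)^-1); apply: filterS2 hB hx => k h1 h2.
by apply: horner_bound h1 _ => //; rewrite divfK // gt_eqF.
Qed.

Lemma bounded_familyW f (r r' : R) : 0 <= r' <= r -> bounded_family f r -> bounded_family f r'.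
Proof. by move=> h [B hB]; exists B; apply: filterS hB => k; exact: coef_boundW. Qed.

Lemma bounded_familyD f g (r : R) : 0 <= r -> bounded_family f r -> bounded_family g r ->
  bounded_family (fun k => f k + g k) r.
Proof.
move=> r0 [B hB] [B' hB']; exists (B + B'); apply: filterS2 hB hB' => k.
exact: coef_boundD.
Qed.

Lemma bounded_familyN f (r : R) : bounded_family f r -> bounded_family (fun k => - f k) r.
Proof. by move=> [B hB]; exists B; apply: filterS hB => k; exact: coef_boundN. Qed.

Lemma bounded_familyB f g (r : R) : 0 <= r -> bounded_family f r -> bounded_family g r ->
  bounded_family (fun k => f k - g k) r.
Proof. by move=> r0 hf hg; apply: bounded_familyD => //; exact: bounded_familyN. Qed.

Lemma bounded_familyM f g (r' r : R) : 0 <= r' < r -> bounded_family f r ->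
  bounded_family g r ->
  bounded_family (fun k => f k * g k) r'.
Proof.
move=> /andP[s0 sr] [B hB] [B' hB']; have r0 : 0 < r by apply: le_lt_trans sr.
have q01 : 0 <= r' / r < 1 by rewrite divr_ge0 ?(ltW r0) //= ltr_pdivrMr // mul1r.
exists ((1 - r' / r)^-1 * (B * B')); apply: filterS2 hB hB' => k h1 h2.
by have := coef_boundM (ltW r0) q01 h1 h2; rewrite divfK // gt_eqF.
Qed.

Lemma bounded_familyXderiv f (r' r : R) : 0 <= r' < r -> bounded_family f r ->
  bounded_family (fun k => 'X * (f k)^`()) r'.
Proof.
move=> /andP[s0 sr] [B hB]; have r0 : 0 < r by apply: le_lt_trans sr.
have q01 : 0 <= r' / r < 1 by rewrite divr_ge0 ?(ltW r0) //= ltr_pdivrMr // mul1r.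
exists ((1 - r' / r)^-1 * B); apply: filterS hB => k h1.
by have := coef_boundXderiv (ltW r0) q01 h1; rewrite divfK // gt_eqF.
Qed.

Lemma bounded_family_comp f (r s : R) : 0 <= s -> s ^+ 2 <= r -> bounded_family f r ->
  bounded_family (fun k => f k \Po 'X^2) s.
Proof. by move=> s0 sr [B hB]; exists B; apply: filterS hB => k; exact: coef_bound_comp. Qed.

Lemma bounded_family_take f (r : R) (m : nat -> nat) : bounded_family f r ->
  bounded_family (fun k => take_poly (m k) (f k)) r.
Proof. by move=> [B hB]; exists B; apply: filterS hB => k; exact: coef_bound_take. Qed.

Lemma bounded_familyZX z (r : R) : 0 <= r -> bounded_along z ->
  bounded_family (fun k => z k *: 'X) r.
Proof.
move=> r0 [B hB]; exists (B * r); apply: filterS hB => k h.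
apply: coef_boundW (coef_boundZX (z k) r0); first by rewrite r0 lexx.
by rewrite ler_wpM2r.
Qed.

End Infinitesimals.

(** * Removing a simple zero and concluding for families *)

Section Quotient.
Variable R : realType.
Local Notation C := R[i].

(** Downward induction from beyond the degree, using [q_j = p_(j+1) + t q_(j+1)]. The constant [M]
    is the fixed point of [r M = B + r' M], so no radius is lost. *)
Lemma coef_bound_quotient (p q : {poly C}) (t : C) (r' r B : R) : 0 <= r' < r ->
  cmod t <= r' -> p = q * ('X - t%:P) -> coef_bound p r B -> coef_bound q r (B / (r - r')).
Proof.
move=> /andP[r'0 rr] tr Dp hp; set M := B / _.
have r0 : 0 < r by apply: le_lt_trans rr.
have B0 := coef_bound_ge0 hp; have d0 : 0 < r - r' by rewrite subr_gt0.
have M0 : 0 <= M by rewrite divr_ge0 // ltW.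
suff H d j : (size q <= j + d)%N -> cmod q`_j * r ^+ j <= M.
  by move=> j; apply: (H (size q)); rewrite leq_addl.
elim: d j => [|d IH] j hj; first by rewrite addn0 in hj; rewrite nth_default // cmod0 mul0r.
have {IH} h1 : cmod q`_j.+1 * r ^+ j.+1 <= M by apply: IH; rewrite addSnnS.
have h2 := hp j.+1.
have -> : q`_j = p`_j.+1 + t * q`_j.+1.
  by rewrite Dp mulrBr coefB coefMX coefMC /= [t * _]mulrC subrK.
rewrite -(ler_pM2r r0) -mulrA -exprSr.
apply: le_trans (ler_wpM2r _ (ler_cmodD _ _)) _; first by rewrite exprn_ge0 // ltW.
rewrite mulrDl cmodM -mulrA; have MB : M * (r - r') = B by rewrite divfK // gt_eqF.
have : cmod t * (cmod q`_j.+1 * r ^+ j.+1) <= r' * M.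
  by apply: ler_pM; rewrite ?mulr_ge0 ?cmod_ge0 ?exprn_ge0 // ltW.
by move: h2 MB; lra.
Qed.

End Quotient.

Section UniqueSimpleRoot.
Variables (R : realType) (F : set_system nat).
Hypothesis FU : UltraFilter F.
Local Notation C := R[i].

Let PF : ProperFilter F. Proof. exact: ultra_proper. Qed.
Local Existing Instance PF.

Definition root_seq (p : nat -> {poly C}) (rho : R) (x : nat -> C) :=
  \forall k \near F, cmod (x k) <= rho /\ root (p k) (x k).

Lemma near_choice (P : nat -> C -> Prop) : (\forall k \near F, exists x, P k x) ->
  exists x : nat -> C, \forall k \near F, P k (x k).
Proof.
move=> h; have /choice [x hx] : forall k, exists x, (exists y, P k y) -> P k x.
  by move=> k; have [[y hy]|n] := pselect (exists y, P k y); [exists y|exists 0].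
by exists x; apply: filterS h => k; exact: hx.
Qed.

(** Uniqueness and simplicity of the zero are only assumed up to infinitesimals; dividing out the
    zero [t k] converts them into the uniform hypotheses of [coef_neq0_simple_root]. The gap between
    [r'] and [rho] provides the ratio [th < 1]. *)
Lemma near_coef_neq0 (n : nat -> nat) (p A : nat -> {poly C}) (r' rho r1 : R) :
  0 < r' < rho -> rho < r1 ->
  (forall m, \forall k \near F, (m <= n k)%N) ->
  bounded_family F p r1 -> (forall k, (p k)`_0 = 1) -> (forall k, (A k)`_0 = 1) ->
  (forall k, eq_upto (n k).+1 (A k * A k) (p k)) ->
  (\forall k \near F, exists x, cmod x <= r' /\ root (p k) x) ->
  (forall x y, root_seq p rho x -> root_seq p rho y -> infsm F (fun k => x k - y k)) ->
  (forall x, root_seq p rho x -> ~ infsm F (fun k => x k * (p k)^`().[x k])) ->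
  \forall k \near F, (A k)`_(n k) != 0.
Proof.
move=> /andP[r'0 r'rho] rho1 noo [B hB] p0 A0 AA ex_root uniq_root simple_root.
have rho0 : 0 < rho by apply: lt_trans r'rho.
have r10 : 0 < r1 by apply: lt_trans rho1.
have r'1 : r' < r1 by apply: lt_trans rho1.
have [t ht] := near_choice ex_root.
have rt : root_seq p rho t.
  by apply: filterS ht => k [h1 h2]; split => //; rewrite (le_trans h1) // ltW.
(* The factor [- t k] normalises the cofactor: [p = (1 - x / t) Q] and [Q(t) = - t p'(t)], which
   simplicity bounds away from 0. *)
pose q k := p k %/ ('X - (t k)%:P); pose Q k := - t k *: q k.
have Dp : \forall k \near F, p k = q k * ('X - (t k)%:P).
  by apply: filterS ht => k [_ h]; rewrite divpK // dvdp_XsubCl.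
have t0 : \forall k \near F, t k != 0.
  apply: filterS ht => k [_]; apply: contraTneq => ->.
  by rewrite rootE horner_coef0 p0 oner_neq0.
have DQ : \forall k \near F, p k = (1 - (t k)^-1 *: 'X) * Q k.
  apply: filterS2 Dp t0 => k h1 h2; rewrite [LHS]h1 /Q -scalerAr scalerAl [LHS]mulrC.
  by congr (_ * _); rewrite scalerBr scalerA mulNr mulfV // scaleN1r opprK alg_polyC polyCN
    addrC.
have [d d0 hd] := not_infsm FU (simple_root t rt).
have Qt : \forall k \near F, d <= cmod (Q k).[t k].
  apply: filterS2 Dp hd => k h1; rewrite {1}h1 derivM derivXsubC !hornerE subrr mulr0 add0r.
  by rewrite -cmodN -mulNr.
have bQ : bounded_family F Q r1.
  exists (r' * (B / (r1 - r'))); apply: filterS3 hB ht Dp => k h1 [h2 _] h3 j.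
  rewrite coefZ cmodM cmodN -mulrA; apply: ler_pM;
    rewrite ?mulr_ge0 ?cmod_ge0 ?exprn_ge0 ?(ltW r10) //.
  by apply: (coef_bound_quotient _ h2 h3 h1); rewrite (ltW r'0).
(* A zero [y] of [Q] is also a zero of [p], hence infinitely close to [t]; by equicontinuity [Q(t)]
   would be infinitesimal. This also excludes double zeros. *)
have nrQ : \forall k \near F, forall x, cmod x <= rho -> ~~ root (Q k) x.
  apply: (near_contra FU) => bad.
  have [|y hy] := @near_choice (fun k y => cmod y <= rho /\ root (Q k) y).
    apply: filterS bad => k /existsNP [y /not_implyP [h1 /negP]]; rewrite negbK.
    by exists y.
  have ry : root_seq p rho y.
    by apply: filterS2 hy DQ => k [h1 h2] ->; rewrite rootM h2 orbT.
  have rho01 : 0 <= rho < r1 by rewrite (ltW rho0).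
  have yb : \forall k \near F, cmod (y k) <= rho by apply: filterS hy => k [].
  have tb : \forall k \near F, cmod (t k) <= rho by apply: filterS rt => k [].
  have := horner_equicontinuous FU rho01 bQ tb yb (uniq_root _ _ rt ry).
  move/(_ d d0) => h.
  have /filter_ex [k] : \forall k \near F, cmod (Q k).[t k] < d /\ d <= cmod (Q k).[t k].
    apply: filterS3 h hy Qt => k h1 [_ /rootP h2] h3.
    by move: h1; rewrite h2 subr0.
  by case; rewrite ltNge => /negP.
have [B' hB'] := bQ; have rq : 0 <= rho / r1 < 1.
  by rewrite divr_ge0 ?ltW //= ltr_pdivrMr // mul1r.
have th01 : 0 <= r' / rho < 1 by rewrite divr_ge0 ?ltW //= ltr_pdivrMr // mul1r.
have [n0 hn0] := coef_neq0_simple_root (B' * (1 - rho / r1)^-1) rho0 th01 d0.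
near=> k.
have h1 : (n0 <= n k)%N by near: k; exact: noo.
have h2 : forall x, cmod x <= rho -> ~~ root (Q k) x by near: k.
have h3 : t k != 0 by near: k.
have h4 : p k = (1 - (t k)^-1 *: 'X) * Q k by near: k.
have h5 : d <= cmod (Q k).[t k] by near: k.
have h6 : coef_bound (Q k) r1 B' by near: k.
have [h7 _] : cmod (t k) <= r' /\ root (p k) (t k) by near: k.
apply: (hn0 _ h1 (Q k) (A k) (t k)) => //.
- have := p0 k; rewrite {1}h4 coefM big_ord1 coefB coef1 coefZ coefX mulr0 subr0.
  by rewrite mul1r.
- by move=> x hx; apply: horner_bound h6 _ => //; rewrite divfK // gt_eqF.
- by rewrite divfK // gt_eqF.
- by rewrite -h4; exact: AA.
Unshelve. all: by end_near. Qed.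

End UniqueSimpleRoot.

(** * The generating function of the Mandelbrot polynomials *)

Section MandelbrotCoefficients.
Variable R : realType.
Local Notation C := R[i].

(** With the value 1 at index 0, the two extreme terms of the full convolution contribute [2 M_n],
    which absorbs the factors 1/2 of the recursion. *)
Definition mcoef (c : C) (n : nat) : C :=
  if n == 0%N then 1 else (map_poly ratr (mandelbrot_poly n)).[- c / 2].

Lemma mcoef_conv (c : C) n : (0 < n)%N ->
  \sum_(i < n.+1) mcoef c i * mcoef c (n - i) =
  (if odd n then 0 else mcoef c n./2) - (if n == 1%N then c else 0).
Proof.
case: n => [//|[|n]] _.
  rewrite big_ord_recl big_ord1 /mcoef /= mul1r mulr1 map_polyX hornerX sub0r.
  by field.
have S (f : nat -> C) : f 0%N = 1 -> \sum_(i < n.+3) f i * f (n.+2 - i)%N =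
    2 * f n.+2 + \sum_(1 <= i < n.+2) f i * f (n.+2 - i)%N.
  move=> f0; rewrite -(big_mkord predT (fun i => f i * f (n.+2 - i)%N)).
  rewrite big_ltn // big_nat_recr //= subn0 subnn f0 mul1r mulr1.
  by ring.
have T : \sum_(1 <= i < n.+2) mcoef c i * mcoef c (n.+2 - i) =
    (map_poly ratr (\sum_(1 <= i < n.+2) mandelbrot_poly i * mandelbrot_poly (n.+2 -
      i)%N)).[- c / 2].
  rewrite rmorph_sum horner_sum; apply: eq_big_nat => i /andP[i1 i2].
  by rewrite rmorphM hornerM /mcoef subn_eq0 leqNgt i2 /= (gtn_eqF i1).
rewrite (S (mcoef c)) // {}T subr0 [mcoef c n.+2]/mcoef.
have nz2 : (2 : C) != 0 by rewrite pnatr_eq0.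
have r2 : ratr (2^-1 : rat) = 2^-1 :> C by rewrite fmorphV rmorph_nat.
case: ifPn => on.
  rewrite mandelbrot_poly_odd // rmorphN /= map_polyZ hornerN hornerZ /= r2.
  by rewrite mulrN mulrA mulfV // mul1r addNr.
rewrite mandelbrot_poly_even // rmorphB /= !map_polyZ hornerD hornerN !hornerZ /= r2.
rewrite mulrBr !mulrA mulfV // !mul1r subrK /mcoef.
by case: eqP => // /eqP; rewrite -[n.+2./2]/(n./2.+1).
Qed.

Definition gen_poly (c : C) n : {poly C} := \poly_(i < n.+1) mcoef c i.

Lemma coef_gen c n i : (gen_poly c n)`_i = if (i <= n)%N then mcoef c i else 0.
Proof. by rewrite coef_poly. Qed.

Lemma gen0 c n : (gen_poly c n)`_0 = 1.
Proof. by rewrite coef_gen. Qed.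

(** Because of the substitution [x^2], coefficients up to about [n / 2] determine the right-hand
    side up to [n]. This makes the induction in [mcoef_small] possible. *)
Lemma gen_sqr c n m : (n <= m.*2.+1)%N ->
  eq_upto n.+1 (gen_poly c n * gen_poly c n) (gen_poly c m \Po 'X^2 - c *: 'X).
Proof.
move=> nm i ni; have {}ni : (i <= n)%N by [].
rewrite coefM coefB coef_comp_poly_Xn // coefZ coefX dvdn2 divn2 coef_gen.
have -> : (i./2 <= m)%N by rewrite -(half_bit_double m true) add1n half_leq // (leq_trans ni).
rewrite (eq_bigr (fun j : 'I_i.+1 => mcoef c j * mcoef c (i - j))) => [|j _]; last first.
  have jn : (j <= n)%N by rewrite (leq_trans _ ni) // -ltnS.
  have ijn : (i - j <= n)%N by rewrite (leq_trans _ ni) // leq_subr.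
  by rewrite !coef_gen jn ijn.
case: i ni => [|i] ni; first by rewrite big_ord1 /= mulr0 subr0 /mcoef mul1r.
rewrite mcoef_conv // if_neg; congr (_ - _).
by case: eqP => _; rewrite ?mulr1 ?mulr0.
Qed.

(** The bound 2 reproduces itself. If it holds up to half the index, then [G(x^2) - c x] is within
    1/2 of 1 on [|x| <= rho], so it has no zero and is at most 3/2, and its square root has weighted
    coefficients at most [sqrt 3 <= 2]. *)
Lemma mcoef_small (c : C) (rho : R) : 0 < rho <= 16^-1 -> cmod c * rho <= 4^-1 ->
  forall j, cmod (mcoef c j) * rho ^+ j <= 2.
Proof.
move=> /andP[rho0 rho16] crho; elim/ltn_ind => [[|n]] IH.
  by rewrite /mcoef /= cmod1 mul1r ler1n.
pose G := gen_poly c n.+1./2.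
have bG : coef_bound G rho 2.
  move=> j; rewrite coef_gen; case: ifP => [jn|]; last by rewrite cmod0 mul0r.
  by apply: IH; rewrite ltnS (leq_trans jn) // leq_half_double -addnn -addSn leq_addr.
have p0 : (G \Po 'X^2 - c *: 'X)`_0 = 1.
  by rewrite coefB coef_comp_poly_Xn // coefZ coefX mulr0 subr0 gen0.
have near1 x : cmod x <= rho -> cmod ((G \Po 'X^2 - c *: 'X).[x] - 1) <= 2^-1.
  move=> hx.
  have -> : (G \Po 'X^2 - c *: 'X).[x] - 1 = (G - 1).[x ^+ 2] - c * x.
    by rewrite !(hornerE, horner_comp) addrAC.
  apply: le_trans (ler_cmodB _ _) _.
  have h1 : cmod (c * x) <= 4^-1 by rewrite cmodM (le_trans _ crho) // ler_wpM2l ?cmod_ge0.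
  have q01 : 0 <= rho < 1 by apply/andP; split; lra.
  have bd : coef_bound (G - 1) rho 2.
    case=> [|j]; first by rewrite coefB coef1 gen0 subrr cmod0 mul0r.
    by rewrite coefB coef1 subr0.
  have h2 : cmod (G - 1).[x ^+ 2] <= 2 * (1 - rho)^-1 * rho ^+ 1.
    apply: horner_bound_tail bd _ _ => //.
      by case => // _; rewrite coefB coef1 gen0 subrr.
    by rewrite cmodX -expr2 lerXn2r // nnegrE ?cmod_ge0 // ltW.
  have h3 : 2 * (1 - rho)^-1 * rho ^+ 1 <= 4^-1.
    rewrite expr1 mulrAC ler_pdivrMr; last lra.
    lra.
  lra.
have nr x : cmod x <= rho -> ~~ root (G \Po 'X^2 - c *: 'X) x.
  move/near1; apply: contraTN => /rootP ->; rewrite sub0r cmodN cmod1 -ltNge.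
  by rewrite invf_lt1 ?ltr1n.
have pB x : cmod x <= rho -> cmod (G \Po 'X^2 - c *: 'X).[x] <= 3 / 2.
  move/near1 => h; rewrite -[_.[x]](subrK 1) (le_trans (ler_cmodD _ _)) // cmod1; lra.
have nn : (n.+1 <= (n.+1./2).*2.+1)%N by rewrite -{1}(odd_double_half n.+1) -[X in (_ <=
  X)%N]add1n leq_add2r leq_b1.
have := sqrt_coef_estimate rho0 p0 nr pB (gen0 c n.+1) (gen_sqr c nn) (ltnSn n.+1).
rewrite coef_gen leqnn => h; apply: le_trans h _.
rewrite -[leRHS]ger0_norm // -sqrtr_sqr ler_wsqrtr //; lra.
Qed.

End MandelbrotCoefficients.

(** * Parameters converging outside the Mandelbrot set *)

Section BoundedParameters.
Variables (R : realType) (F : set_system nat).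
Hypothesis FU : UltraFilter F.
Local Notation C := R[i].

Let PF : ProperFilter F. Proof. exact: ultra_proper. Qed.
Local Existing Instance PF.

Variables (c : nat -> C) (n : nat -> nat) (cs : C).
Hypothesis noo : forall m, \forall k \near F, (m <= n k)%N.
Hypothesis c_lim : infsm F (fun k => c k - cs).

Let G k := gen_poly (c k) (n k).
(** Chosen so that [V(x^2)] is the image of [G(x^2)] under [x d/dx - 1]. This operator kills [c x]
    and acts on the [j]-th coefficient by [j - 1], so the parameter drops out of the identities for
    [V]. *)
Let V k := 2 *: ('X * (G k)^`()) - G k.

Lemma bounded_c : bounded_along F c.
Proof.
have h := bounded_alongD FU (infsm_bounded FU c_lim) (bounded_cst FU cs).
by case: h => B hB; exists B; apply: filterS hB => k; rewrite subrK.
Qed.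

Lemma bounded_family_gen_comp (r s : R) : 0 <= s -> s ^+ 2 <= r -> bounded_family F G r ->
  bounded_family F (fun k => G k \Po 'X^2 - c k *: 'X) s.
Proof.
move=> s0 sr bG; apply: bounded_familyB => //; first exact: (bounded_family_comp FU s0 sr bG).
exact: bounded_familyZX bounded_c.
Qed.

Lemma coefV k j : (V k)`_j = (2 * j%:R - 1) * (G k)`_j.
Proof. by rewrite coefB coefZ coefXderiv -(mulr_natl (G k)`_j); ring. Qed.

Lemma coefV_comp k j : (V k \Po 'X^2)`_j = (j%:R - 1) * (G k \Po 'X^2 - c k *: 'X)`_j.
Proof.
rewrite coefB !coef_comp_poly_Xn // coefZ coefX.
case: dvdnP => [[i ->]|_].
  rewrite mulnK // coefV natrM [i%:R * _]mulrC; case: eqP => [/(congr1 odd)|_].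
    by rewrite muln2 odd_double.
  by rewrite mulr0 subr0.
case: eqP => [->|_]; first by rewrite subrr mul0r.
by rewrite mulr0 subr0 mulr0.
Qed.

Lemma bounded_V (r' r : R) : 0 <= r' < r -> bounded_family F G r -> bounded_family F V r'.
Proof.
move=> rr bG; have /andP[r'0 r'r] := rr.
have b1 := bounded_familyXderiv FU rr bG.
apply: bounded_familyB => //; last by apply: bounded_familyW bG; rewrite r'0 ltW.
have [B hB] := b1; exists (2 * B); apply: filterS hB => k h j.
by rewrite coefZ cmodM cmodn -mulrA ler_pM2l.
Qed.

Lemma mid_radius (r s : R) : 0 <= s < r -> r <= 1 ->
  [/\ 0 <= s < (s + r) / 2, 0 <= (s + r) / 2 < r & ((s + r) / 2) ^+ 2 <= r].
Proof.
move=> /andP[s0 sr] r1; split; try by apply/andP; split; lra.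
have : 0 <= (s + r) / 2 <= r by apply/andP; split; lra.
by move=> /andP[]; move: ((s + r) / 2) => m m0 mr; rewrite expr2; nra.
Qed.

(** For fixed [j], the [j]-th coefficients of both sides agree as soon as [j <= n k], so the
    truncation error is coefficientwise infinitesimal, and the common bound makes its values
    infinitesimal. *)
Lemma gen_functional (r s : R) (x : nat -> C) : 0 <= s < r -> r <= 1 ->
  bounded_family F G r -> (\forall k \near F, cmod (x k) <= s) ->
  infsm F (fun k => (G k).[x k] ^+ 2 - ((G k).[x k ^+ 2] - c k * x k)).
Proof.
move=> sr r1 bG hx; have [h1 h2 h3] := mid_radius sr r1.
have h20 : 0 <= (s + r) / 2 by case/andP: h2.
pose f k := G k * G k - (G k \Po 'X^2 - c k *: 'X).
have bf : bounded_family F f ((s + r) / 2).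
  apply: bounded_familyB => //; first exact: (bounded_familyM FU h2 bG bG).
  exact: (bounded_family_gen_comp h20 h3 bG).
apply: infsm_eq (horner_infsm FU h1 bf hx _).
  by apply: nearW => k; rewrite /f !(hornerE, horner_comp) expr2.
move=> j; apply: infsm_eq (infsm0 FU); apply: filterS (noo j) => k jk.
rewrite coefB (@gen_sqr _ _ _ (n k)) ?subrr // ltnW // ltnS -addnn leq_addr //.
Qed.

(** Apply [x d/dx - 1] to both sides of the functional equation: [G^2] becomes
    [2 x G G' - G^2 = G V], and [G(x^2) - c x] becomes [V(x^2)]. *)
Lemma V_functional (r s : R) (x : nat -> C) : 0 <= s < r -> r <= 1 ->
  bounded_family F G r -> (\forall k \near F, cmod (x k) <= s) ->
  infsm F (fun k => (G k).[x k] * (V k).[x k] - (V k).[x k ^+ 2]).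
Proof.
move=> sr r1 bG hx; have [h1 h2 h3] := mid_radius sr r1.
have [h4 h5 h6] := mid_radius h2 r1; set r' := (s + r) / 2 in h1 h2 h3 h4 h5 h6.
set r2 := (r' + r) / 2 in h4 h5 h6.
have h20 : 0 <= r' by case/andP: h2.
have bV : bounded_family F V r2 := bounded_V h5 bG.
have bG2 : bounded_family F G r2 by apply: bounded_familyW bG; case/andP: h5 => -> /ltW.
pose f k := G k * V k - (V k \Po 'X^2).
have bf : bounded_family F f r'.
  apply: bounded_familyB => //; first exact: (bounded_familyM FU h4 bG2 bV).
  have h7 : r' ^+ 2 <= r2.
    case/andP: h4 => _ h4; rewrite expr2 (le_trans _ (ltW h4)) // ler_piMr //.
    by case/andP: h2 => _ /ltW /le_trans; apply.
  exact: (bounded_family_comp FU h20 h7 bV).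
apply: infsm_eq (horner_infsm FU h1 bf hx _).
  by apply: nearW => k; rewrite /f !(hornerE, horner_comp).
move=> j; apply: infsm_eq (infsm0 FU); apply: filterS (noo j) => k jk.
have GV : (G k * V k)`_j = (j%:R - 1) * (G k * G k)`_j.
  have -> : G k * V k = 'X * (G k * G k)^`() - G k * G k.
    rewrite /V derivM mulrBr; congr (_ - _).
    by rewrite -scalerAr scaler_nat mulrDr mulr2n; congr (_ + _);
      rewrite [LHS]mulrCA // [G k * _]mulrC.
  by rewrite coefB coefXderiv -(mulr_natl (G k * G k)`_j); ring.
rewrite coefB GV (@gen_sqr _ _ _ (n k)) ?ltnS //; last by rewrite ltnW // ltnS -addnn leq_addr.
by rewrite -coefV_comp subrr.
Qed.

(** Through [V(x^2) = G(x) V(x)] an infinitesimal value at [u] passes to every [u^(2^i)]. These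
    points tend to 0, where [V] is close to its constant coefficient [-1]. *)
Lemma V_not_infsm (r s : R) (u : C) : 0 <= s < r -> r <= 1 -> bounded_family F G r ->
  cmod u <= s -> ~ infsm F (fun k => (V k).[u]).
Proof.
move=> sr r1 bG us hu; have /andP[s0 sr'] := sr.
have s1 : 0 <= s < 1 by rewrite s0 (lt_le_trans sr').
have pw i : cmod (u ^+ (2 ^ i)%N) <= s.
  rewrite cmodX; apply: le_trans (_ : cmod u ^+ 1 <= _); last by rewrite expr1.
  rewrite ler_wiXn2l ?cmod_ge0 ?expn_gt0 // (le_trans us) // ltW //; by case/andP: s1.
have sq_iter i : infsm F (fun k => (V k).[u ^+ (2 ^ i)%N]).
  elim: i => [|i IH]; first by rewrite expn0 expr1.
  have h := V_functional sr r1 bG (near_all FU (fun=> pw i)).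
  have b := horner_bounded FU sr bG (near_all FU (fun=> pw i)).
  apply: infsm_eq (infsmB FU (infsmMl FU b IH) h); apply: nearW => k.
  by rewrite subKr -exprM expnSr.
have [h1 h2 h3] := mid_radius sr r1; set r' := (s + r) / 2 in h1 h2 h3.
have r'0 : 0 < r' by case/andP: h1 => ha hb; exact: (le_lt_trans ha hb).
have [B hB] := bounded_V h2 bG.
have B1 : 0 < 4 * (`|B| + 1) by rewrite mulr_gt0 // ltr_wpDl.
pose th := Num.min (2^-1) (4 * (`|B| + 1))^-1.
have th0 : 0 < th by rewrite lt_min !invr_gt0 B1 ltr0n.
have th2 : th <= 2^-1 by rewrite ge_min lexx.
have thB : th * (4 * (`|B| + 1)) <= 1 by rewrite -ler_pdivlMr // div1r ge_min lexx orbT.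
have [i hi] := geom_small s1 (mulr_gt0 th0 r'0).
have small : cmod (u ^+ (2 ^ i)%N) <= th * r'.
  rewrite cmodX; apply/ltW/(le_lt_trans _ (hi (2 ^ i)%N (ltnW (ltn_expl i (ltnSn 1))))).
  by rewrite lerXn2r // nnegrE cmod_ge0.
have e4 : 0 < 4^-1 :> R by rewrite invr_gt0.
have /filter_ex [k [h4 h5]] : F ([set k | coef_bound (V k) r' B] `&`
    [set k | cmod (V k).[u ^+ (2 ^ i)%N] < 4^-1]).
  by apply: filterI => //; exact: sq_iter.
have V0 : (V k)`_0 = -1 by rewrite coefV gen0 mulr0 sub0r mulr1.
have bd : coef_bound (V k + 1) r' `|B|.
  case=> [|j]; first by rewrite coefD coef1 V0 addNr cmod0 mul0r.
  by rewrite coefD coef1 addr0 (le_trans (h4 _)) // ler_norm.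
have th01 : 0 <= th < 1 by apply/andP; split; lra.
have : cmod (V k + 1).[u ^+ (2 ^ i)%N] <= `|B| * (1 - th)^-1 * th ^+ 1.
  apply: horner_bound_tail bd _ small => //.
  by case=> // _; rewrite coefD coef1 V0 addNr.
rewrite hornerD hornerC => h6.
have h7 : `|B| * (1 - th)^-1 * th ^+ 1 <= 2^-1.
  rewrite expr1 mulrAC ler_pdivrMr; last lra.
  by have := normr_ge0 B; nra.
have : 1 <= cmod ((V k).[u ^+ (2 ^ i)%N] + 1) + cmod (V k).[u ^+ (2 ^ i)%N].
  by rewrite -[leLHS](@cmod1 R) (le_trans _ (ler_cmodB _ _)) // addrAC subrr add0r.
move: h5 => /=; lra.
Qed.

(* In the coordinate [psi x = G (x^2) / x], the inverse of the Boettcher map up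
   to [x |-> 1/x], [psi_at x w] says that [psi x = w]. *)
Definition psi_at (x w : C) := infsm F (fun k => (G k).[x ^+ 2] - w * x).

Lemma psi_at_sqr (r s : R) (x w : C) : 0 <= s < r -> r <= 1 -> bounded_family F G r ->
  cmod (x ^+ 2) <= s -> psi_at x w -> psi_at (x ^+ 2) (w ^+ 2 + cs).
Proof.
move=> sr r1 bG xs h.
have h1 := gen_functional sr r1 bG (near_all FU (fun=> xs)).
have b : bounded_along F (fun k => (G k).[x ^+ 2] + w * x).
  apply: bounded_alongD => //; last exact: bounded_cst.
  exact: (horner_bounded FU sr bG (near_all FU (fun=> xs))).
have h2 := infsmMl FU b h.
have h3 := infsmMl FU (bounded_cst FU (x ^+ 2)) c_lim.
apply: infsm_eq (infsmD FU (infsmB FU h2 h1) h3); apply: nearW => k.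
by ring.
Qed.

(** Near 0, [psi] behaves like [1 / x]. Eliminating [w] leaves [y G(x^2) - x G(y^2)], which is
    [-(x - y)] plus an error of at most half its size. *)
Lemma psi_at_inj_near0 (r : R) : 0 < r -> r <= 1 -> bounded_family F G r ->
  exists2 e : R, 0 < e & forall x y w, cmod x <= e -> cmod y <= e ->
    psi_at x w -> psi_at y w -> x = y.
Proof.
move=> r0 r1 [B hB]; have B1 : 0 < 16 * (`|B| + 1) by rewrite mulr_gt0 // ltr_wpDl.
pose q := Num.min (2^-1) (16 * (`|B| + 1))^-1.
have q0 : 0 < q by rewrite lt_min !invr_gt0 B1 ltr0n.
have q2 : q <= 2^-1 by rewrite ge_min lexx.
have qB : q * (16 * (`|B| + 1)) <= 1 by rewrite -ler_pdivlMr // div1r ge_min lexx orbT.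
have q01 : 0 <= q < 1 by apply/andP; split; lra.
exists (q * r); first exact: mulr_gt0.
move=> x y w hx hy h1 h2.
have h3 : infsm F (fun k => y * (G k).[x ^+ 2] - x * (G k).[y ^+ 2]).
  apply: infsm_eq (infsmB FU (infsmMl FU (bounded_cst FU y) h1) (infsmMl FU (bounded_cst FU
    x) h2)).
  by apply: nearW => k; ring.
have low : \forall k \near F, cmod (x - y) / 2 <= cmod (y * (G k).[x ^+ 2] - x * (G k).[y ^+
  2]).
  apply: filterS hB => k hk.
  pose D := G k - 1.
  have -> : y * (G k).[x ^+ 2] - x * (G k).[y ^+ 2] =
      (y * D.[x ^+ 2] - x * D.[y ^+ 2]) - (x - y) by rewrite /D !hornerE; ring.
  suff : cmod (y * D.[x ^+ 2] - x * D.[y ^+ 2]) <= cmod (x - y) / 2.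
    by move=> h; have := lerB_cmod (x - y) (y * D.[x ^+ 2] - x * D.[y ^+ 2]); rewrite cmodBC;
      lra.
  have er : q * r <= 1 by rewrite mulr_ile1 ?(ltW q0) ?(ltW r0) //; lra.
  (* The difference [y x^(2i) - x y^(2i)] equals [x y (x^(2i-1) - y^(2i-1))] for [i > 0], so it is
     divisible by [x - y]; the number of terms in the quotient is absorbed by one power of
     [q <= 1/2]. *)
  have term i : cmod (D`_i * (y * x ^+ (2 * i) - x * y ^+ (2 * i))) <=
      (4 * `|B| * q) * q ^+ i * cmod (x - y).
    case: i => [|i]; first by rewrite coefB coef1 gen0 subrr mul0r cmod0 !mulr_ge0 ?exprn_ge0
      ?cmod_ge0 ?(ltW q0).
    rewrite coefB coef1 subr0 mulnS add2n.
    have -> : y * x ^+ (2 * i).+2 - x * y ^+ (2 * i).+2 =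
        x * y * (x ^+ (2 * i).+1 - y ^+ (2 * i).+1) by rewrite !exprS; ring.
    rewrite subrXX /=.
    have -> : cmod ((G k)`_i.+1 * (x * y * ((x - y) * \sum_(j < (2 * i).+1) x ^+ (2 * i - j)
      * y ^+ j))) =
        cmod (G k)`_i.+1 * (cmod x * cmod y) * cmod (\sum_(j < (2 * i).+1) x ^+ (2 * i - j) *
          y ^+ j) * cmod (x - y).
      by rewrite !cmodM; ring.
    rewrite ler_wpM2r ?cmod_ge0 //.
    have S : cmod (\sum_(j < (2 * i).+1) x ^+ (2 * i - j) * y ^+ j) <= (2 * i).+1%:R * (q *
      r) ^+ (2 * i).
      apply: le_trans (ler_cmod_sum _ _ _) _.
      rewrite mulr_natl -[in leRHS](card_ord (2 * i).+1) -sumr_const; apply: ler_sum => j _.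
      have -> : (q * r) ^+ (2 * i) = (q * r) ^+ (2 * i - j) * (q * r) ^+ j.
        by rewrite -exprD subnK // -ltnS.
      by rewrite cmodM !cmodX; apply: ler_pM; rewrite ?exprn_ge0 ?cmod_ge0 // lerXn2r //
        nnegrE ?cmod_ge0 // mulr_ge0 // ltW.
    have xy : cmod x * cmod y <= (q * r) * (q * r) by apply: ler_pM; rewrite ?cmod_ge0.
    have := hk i.+1 => hki.
    have i2 : (2 * i).+1%:R * q ^+ i <= 4.
      apply: le_trans (_ : 2 * (i.+1%:R * q ^+ i) <= _).
        by rewrite mulrA ler_wpM2r ?exprn_ge0 ?(ltW q0) // -natrM ler_nat mulnS addSn ltnS
          leqnSn.
      have := linear_geom_le i q01; have : (1 - q)^-1 <= 2.
        by rewrite -[leRHS]invrK lef_pV2 ?posrE ?invr_gt0 //; lra.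
      lra.
    have S' : cmod (\sum_(j < (2 * i).+1) x ^+ (2 * i - j) * y ^+ j) <= 4 * (q ^+ i * r ^+ i).
      apply: le_trans S _; rewrite exprMn.
      have -> : (2 * i).+1%:R * (q ^+ (2 * i) * r ^+ (2 * i)) =
          ((2 * i).+1%:R * q ^+ i) * (q ^+ i * r ^+ i * r ^+ i) by rewrite mul2n -addnn
            !exprD; ring.
      apply: ler_pM => //; first by rewrite mulr_ge0 ?exprn_ge0 // ltW.
        by rewrite !mulr_ge0 ?exprn_ge0 // ltW.
      by rewrite ler_piMr ?exprn_ile1 // ?(ltW r0) // mulr_ge0 ?exprn_ge0 // ltW.
    set a := cmod (G k)`_i.+1 in hki *; set sm := cmod (\sum_(j < _) _) in S' *.
    have a0 : 0 <= a := cmod_ge0 _.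
    apply: le_trans (_ : a * (q * r * (q * r)) * (4 * (q ^+ i * r ^+ i)) <= _).
      apply: ler_pM; rewrite ?mulr_ge0 ?cmod_ge0 //.
      exact: ler_wpM2l.
    have -> : a * (q * r * (q * r)) * (4 * (q ^+ i * r ^+ i)) =
        4 * (a * r ^+ i.+1) * r * (q * q ^+ i.+1) by rewrite !exprS; ring.
    have -> : 4 * `|B| * q * q ^+ i.+1 = 4 * `|B| * 1 * (q * q ^+ i.+1) by ring.
    apply: ler_wpM2r; first by rewrite mulr_ge0 ?exprn_ge0 // ltW.
    apply: ler_pM; rewrite ?mulr_ge0 ?exprn_ge0 ?(ltW r0) // ler_pM2l //.
    by rewrite (le_trans hki) // ler_norm.
  have -> : y * D.[x ^+ 2] - x * D.[y ^+ 2] =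
      \sum_(i < size D) D`_i * (y * x ^+ (2 * i) - x * y ^+ (2 * i)).
    rewrite !horner_coef !mulr_sumr -sumrB; apply: eq_bigr => i _.
    by rewrite -!exprM; ring.
  apply: le_trans (ler_cmod_sum _ _ _) _.
  apply: le_trans (_ : \sum_(i < size D) (4 * `|B| * q) * q ^+ i * cmod (x - y) <= _).
    by apply: ler_sum.
  rewrite -mulr_suml -mulr_sumr [leRHS]mulrC ler_wpM2r ?cmod_ge0 //.
  have S0 : 0 <= 4 * `|B| * q by rewrite !mulr_ge0 // ltW.
  apply: le_trans (ler_wpM2l S0 (sum_geom_le (size D) q01)) _.
  rewrite ler_pdivrMr; last lra.
  by have := normr_ge0 B; nra.
apply/eqP; rewrite -subr_eq0 -cmod_eq0 eq_le cmod_ge0 andbT leNgt; apply/negP => xy0.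
have xy2 : 0 < cmod (x - y) / 2 by rewrite divr_gt0.
have /filter_ex [k [h4]] : F ([set k | cmod (x - y) / 2 <= cmod (y * (G k).[x ^+ 2] - x * (G
  k).[y ^+ 2])] `&`
   [set k | cmod (y * (G k).[x ^+ 2] - x * (G k).[y ^+ 2]) < cmod (x - y) / 2]).
  by apply: filterI => //; exact: h3.
by rewrite /= ltNge h4.
Qed.

(* Squaring [x] and [y] repeatedly makes them small, hence equal; as [psi] is
   odd, equality descends through square roots as long as the orbit avoids 0. *)
Lemma psi_at_inj (r s : R) (x y w : C) : 0 <= s < r -> r <= 1 -> bounded_family F G r ->
  (forall m, iter m (fun z => z ^+ 2 + cs) w != 0) ->
  cmod (x ^+ 2) <= s -> cmod (y ^+ 2) <= s -> psi_at x w -> psi_at y w -> x = y.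
Proof.
move=> sr r1 bG; have /andP[s0 sr'] := sr.
have s1 : 0 <= s < 1 by rewrite s0 (lt_le_trans sr').
have [e e0 he] := psi_at_inj_near0 (le_lt_trans s0 sr') r1 bG.
have sq (z : C) : cmod (z ^+ 2) <= s -> cmod ((z ^+ 2) ^+ 2) <= s.
  move=> h; rewrite cmodX expr2 (le_trans _ h) // ler_piMr ?cmod_ge0 //.
  by rewrite (le_trans h) // ltW //; case/andP: s1.
have H i : forall x1 y1 w1 : C, (forall m, iter m (fun z => z ^+ 2 + cs) w1 != 0) ->
    cmod (x1 ^+ 2) <= s -> cmod (y1 ^+ 2) <= s -> psi_at x1 w1 -> psi_at y1 w1 ->
    cmod (x1 ^+ (2 ^ i)%N) <= e -> cmod (y1 ^+ (2 ^ i)%N) <= e -> x1 = y1.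
  elim: i => [|i IH] x1 y1 w1 hw hx hy px py.
    by rewrite expn0 !expr1 => ex ey; exact: (he _ _ w1).
  rewrite expnS !exprM => ex ey.
  have : x1 ^+ 2 = y1 ^+ 2.
    apply: (IH _ _ (w1 ^+ 2 + cs)) => //; try exact: sq.
    - by move=> m; have := hw m.+1; rewrite iterSr.
    - exact: (psi_at_sqr sr r1 bG hx px).
    - exact: (psi_at_sqr sr r1 bG hy py).
  move/eqP; rewrite eqf_sqr => /orP[/eqP //|/eqP xy].
  have w0 : w1 != 0 := hw 0%N.
  have h : infsm F (fun=> w1 * y1 + w1 * y1).
    apply: (infsm_eq FU _ (infsmB FU px py)); apply: nearW => k.
    by rewrite xy sqrrN; ring.
  move/(infsm_cst FU)/eqP: h; rewrite -mulr2n mulrn_eq0 /= mulf_eq0 (negbTE w0) /= => /eqP y0.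
  by rewrite xy y0 oppr0.
move=> hw hx hy px py.
have [j hj] := geom_small s1 e0.
have small (z : C) : cmod (z ^+ 2) <= s -> cmod (z ^+ (2 ^ j.+1)%N) <= e.
  move=> hz; rewrite expnS exprM cmodX; apply/ltW/(le_lt_trans _ (hj (2 ^ j)%N _)).
    by rewrite lerXn2r // nnegrE cmod_ge0.
  by rewrite ltnW // ltn_expl.
exact: (H j.+1 _ _ _ hw hx hy px py (small _ hx) (small _ hy)).
Qed.

(** The functional equation turns the hypothesis into [G(u)^2 = w^2 u] up to infinitesimals. With
    [v^2 = u] this factors as [(G(v^2) - w v) (G(v^2) + w v)]; the second factor is handled by
    replacing [v] with [- v]. *)
Lemma psi_at_sqrt (u w : C) : (forall r : R, 0 <= r < 1 -> bounded_family F G r) ->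
  cmod u < 1 -> psi_at u (w ^+ 2 + cs) -> exists2 v, cmod v < 1 & psi_at v w.
Proof.
move=> bG u1 hu; have u0 := cmod_ge0 u; pose r := (1 + cmod u) / 2.
have ur : 0 <= cmod u < r by rewrite u0 /r; lra.
have r01 : 0 <= r < 1 by apply/andP; rewrite /r; split; lra.
have r1 : r <= 1 by rewrite ltW //; case/andP: r01.
have h1 := gen_functional ur r1 (bG r r01) (near_all FU (fun=> lexx (cmod u))).
have h2 := infsmMl FU (bounded_cst FU u) c_lim.
pose v := sqrtC u; have vu : v ^+ 2 = u by exact: sqrtCK.
have v1 : cmod v < 1.
  by rewrite -(@ltr_pXn2r _ 2) ?nnegrE ?cmod_ge0 // expr1n -cmodX vu.
have h3 : infsm F (fun k => ((G k).[v ^+ 2] - w * v) * ((G k).[v ^+ 2] + w * v)).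
  apply: infsm_eq (infsmB FU (infsmD FU h1 hu) h2); apply: nearW => k.
  by rewrite -vu; ring.
have [h4|h4] := infsm_mul_or FU h3; first by exists v.
exists (- v); first by rewrite cmodN.
by apply: infsm_eq h4; apply: nearW => k; rewrite sqrrN mulrN opprK.
Qed.

(** A zero of [G(x^2) - w x] is sought in [|x| <= 20 / |w|], where this polynomial is at most
    [1 + 1 + 20 = 22]. Its square root starts with [1 - (w / 2) x], whose linear coefficient weighs
    [10 > sqrt 44] at that radius, so a zero exists. *)
Lemma psi_at_surj : bounded_family F G 2^-1 ->
  exists2 K : R, 0 < K & forall w, K <= cmod w -> exists2 u, cmod u < 1 & psi_at u w.
Proof.
move=> bG; have [B hB] := bG.
have B1 : 0 < 2 * (`|B| + 1) by rewrite mulr_gt0 // ltr_wpDl.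
pose q := Num.min (2^-1) (2 * (`|B| + 1))^-1.
have q0 : 0 < q by rewrite lt_min !invr_gt0 B1 ltr0n.
have q2 : q <= 2^-1 by rewrite ge_min lexx.
have qB : q * (2 * (`|B| + 1)) <= 1 by rewrite -ler_pdivlMr // div1r ge_min lexx orbT.
exists (40 / q); first exact: divr_gt0.
move=> w hw; have w0 : 0 < cmod w by apply: lt_le_trans hw; exact: divr_gt0.
pose rho := 20 / cmod w; have rho0 : 0 < rho by exact: divr_gt0.
have rhoq : rho <= q / 2.
  by move: hw; rewrite /rho !ler_pdivrMr // mulrAC ler_pdivlMr // => hw; lra.
pose p k := (G k \Po 'X^2) - w *: 'X.
have p0 k : (p k)`_0 = 1.
  by rewrite coefB coef_comp_poly_Xn // coefZ coefX mulr0 subr0 gen0.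
have bp : bounded_family F p 2^-1.
  apply: bounded_familyB => //; last exact: (bounded_familyZX FU _ (bounded_cst FU w)).
  by apply: (bounded_family_comp FU _ _ bG); rewrite // expr2 ler_piMr // invf_le1 // ler1n.
have ex_root : \forall k \near F, exists x, cmod x <= rho /\ root (p k) x.
  apply: (near_contra FU) => bad.
  have /filter_ex [k [hk]] : F ([set k | coef_bound (G k) 2^-1 B] `&`
      [set k | ~ exists x, cmod x <= rho /\ root (p k) x]) by exact: filterI.
  move=> /forallNP nr.
  have pB x : cmod x <= rho -> cmod (p k).[x] <= 22.
    move=> hx; have -> : (p k).[x] = (G k - 1).[x ^+ 2] + 1 - w * x.
      by rewrite /p !(hornerE, horner_comp) subrK.
    have hwx : cmod (w * x) <= 20.
      by rewrite cmodM mulrC -ler_pdivlMr.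
    have q01 : 0 <= q < 1 by apply/andP; split; lra.
    have bd : coef_bound (G k - 1) 2^-1 `|B|.
      case=> [|j]; first by rewrite coefB coef1 gen0 subrr cmod0 mul0r.
      by rewrite coefB coef1 subr0 (le_trans (hk _)) // ler_norm.
    have h1 : cmod (G k - 1).[x ^+ 2] <= `|B| * (1 - q)^-1 * q ^+ 1.
      apply: (horner_bound_tail _ q01 bd).
      - by rewrite invr_gt0.
      - by case=> // _; rewrite coefB coef1 gen0 subrr.
      - by rewrite cmodX; have := cmod_ge0 x; nra.
    have h2 : `|B| * (1 - q)^-1 * q ^+ 1 <= 1.
      rewrite expr1 mulrAC ler_pdivrMr; last lra.
      by have := normr_ge0 B; nra.
    apply: le_trans (ler_cmodB _ _) _; have := ler_cmodD (G k - 1).[x ^+ 2] 1.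
    by rewrite cmod1; lra.
  pose A : {poly C} := 1 - (w / 2) *: 'X.
  have A0 : A`_0 = 1 by rewrite coefB coef1 coefZ coefX mulr0 subr0.
  have A1 : A`_1 = - (w / 2) by rewrite coefB coef1 coefZ coefX mulr1 sub0r.
  have AA : eq_upto 2 (A * A) (p k).
    case=> [|[|//]] _; first by rewrite coefM big_ord1 A0 p0 mulr1.
    rewrite coefM big_ord_recl big_ord1 /= A0 A1 coefB coef_comp_poly_Xn // coefZ coefX /=.
    by field.
  have nr' x : cmod x <= rho -> ~~ root (p k) x.
    by move=> hx; apply/negP => hr; exact: (nr x).
  have := sqrt_coef_estimate rho0 (p0 k) nr' pB A0 AA (isT : (1 < 2)%N).
  rewrite A1 cmodN cmodM cmodV cmodn expr1 => h.
  have h10 : cmod w / 2 * rho = 10 by rewrite /rho; field; rewrite gt_eqF.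
  have : (10 : R) ^+ 2 <= Num.sqrt (2 * 22) ^+ 2.
    by rewrite lerXn2r ?nnegrE ?sqrtr_ge0 // -h10.
  by rewrite sqr_sqrtr ?mulr_ge0 // -natrX -natrM ler_nat.
have [x hx] := near_choice FU ex_root.
have xb : \forall k \near F, cmod (x k) <= rho by apply: filterS hx => k [].
have [u hu] : exists u, infsm F (fun k => x k - u) by apply: bounded_lim => //; exists rho.
have ub : cmod u <= rho := lim_bound FU hu xb.
exists u; first by apply: le_lt_trans ub _; lra.
have rho2 : 0 <= rho < 2^-1 by rewrite ltW //=; lra.
have h := horner_equicontinuous FU rho2 bp xb (near_all FU (fun=> ub)) hu.
apply: infsm_eq (infsmN FU h); apply: filterS hx => k [_ /rootP ->].
by rewrite sub0r opprK /p !(hornerE, horner_comp).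
Qed.

(* Otherwise [psi] would be defined on the whole punctured unit disk; pulling
   back a large value along the orbit of [cs] would give a point where [psi]
   takes the value [cs], that is, a double zero of [G^2]. *)
Lemma radius_lt1 : (forall K : R, exists m, K <= cmod (iter m (fun z => z ^+ 2 + cs) 0)) ->
  ~ (forall r : R, 0 <= r < 1 -> bounded_family F G r).
Proof.
move=> unb bG.
have noval u : cmod u < 1 -> ~ psi_at u cs.
  move=> u1 hu; have u0 := cmod_ge0 u; pose r := (1 + cmod u) / 2.
  have ur : 0 <= cmod u < r by rewrite u0 /r; lra.
  have r01 : 0 <= r < 1 by apply/andP; rewrite /r; split; lra.
  have r1 : r <= 1 by rewrite ltW //; case/andP: r01.
  have near_u := near_all FU (fun=> lexx (cmod u)).
  have h1 := gen_functional ur r1 (bG r r01) near_u.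
  have h2 := infsmMl FU (bounded_cst FU u) c_lim.
  (* If [psi u = cs], the functional equation reads [G(u)^2 = 0]; then [V(u^2) = G(u) V(u)] vanishes
     too, contrary to [V_not_infsm]. *)
  have Gu : infsm F (fun k => (G k).[u]).
    apply: (infsm_sqr FU); apply: infsm_eq (infsmB FU (infsmD FU h1 hu) h2).
    by apply: nearW => k; ring.
  have h3 := V_functional ur r1 (bG r r01) near_u.
  have [m1 m2 _] := mid_radius ur r1.
  have Vb := horner_bounded FU m1 (bounded_V m2 (bG r r01)) near_u.
  apply: (V_not_infsm (u := u ^+ 2) ur r1 (bG r r01)).
    by rewrite cmodX expr2 ler_piMr // ltW.
  apply: infsm_eq (infsmB FU (infsmMl FU Vb Gu) h3); apply: nearW => k.
  by ring.
have noorb m : forall u, cmod u < 1 -> ~ psi_at u (iter m.+1 (fun z => z ^+ 2 + cs) 0).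
  elim: m => [|m IH] u u1; first by rewrite /= expr0n add0r; exact: noval.
  by rewrite iterS => /(psi_at_sqrt bG u1) [v v1]; exact: IH.
have half01 : 0 <= (2^-1 : R) < 1 by rewrite invr_ge0 ler0n /= invf_lt1 // ltr1n.
have [K K0 hK] := psi_at_surj (bG _ half01).
have [[|m] hm] := unb K; first by move: hm; rewrite /= cmod0 leNgt K0.
by have [u u1] := hK _ hm; exact: noorb.
Qed.

(** A return to 0 would make the critical orbit periodic, hence bounded. This supplies the
    hypothesis of [psi_at_inj] at [w = cs]. *)
Lemma orbit_neq0 : (forall K : R, exists m, K <= cmod (iter m (fun z => z ^+ 2 + cs) 0)) ->
  forall m, iter m (fun z => z ^+ 2 + cs) cs != 0.
Proof.
move=> unb m; apply/eqP => per; pose f := fun z : C => z ^+ 2 + cs.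
have {}per : iter m.+1 f 0 = 0 by rewrite iterSr /f expr0n add0r.
pose S := \sum_(l < m.+1) cmod (iter l f 0).
have bnd j : cmod (iter j f 0) <= S.
  elim/ltn_ind: j => j IH; have [jm|mj] := ltnP j m.+1.
    by rewrite /S (bigD1 (Ordinal jm)) //= lerDl sumr_ge0 // => i _; exact: cmod_ge0.
  rewrite -(subnK mj) iterD per; apply: IH.
  by rewrite -subn_gt0 subKn.
have [j hj] := unb (S + 1); have := le_trans hj (bnd j).
by rewrite gerDl ler10.
Qed.

Lemma near_mcoef_neq0_bounded :
  (forall K : R, exists m, K <= cmod (iter m (fun z => z ^+ 2 + cs) 0)) ->
  \forall k \near F, mcoef (c k) (n k) != 0.
Proof.
move=> unb; have orb := orbit_neq0 unb.
have [Bc hBc] := bounded_c.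
pose S := [set r : R | 0 <= r /\ bounded_family F G r].
have [r0 r00 Sr0] : exists2 r0, 0 < r0 & S r0.
  have Bc4 : 0 < 4 * (`|Bc| + 1) by rewrite mulr_gt0 // ltr_wpDl.
  pose r0 := Num.min (16^-1) (4 * (`|Bc| + 1))^-1.
  have r00 : 0 < r0 by rewrite lt_min !invr_gt0 Bc4 ltr0n.
  have rB : r0 * (4 * (`|Bc| + 1)) <= 1 by rewrite -ler_pdivlMr // div1r ge_min lexx orbT.
  exists r0 => //; split; first exact: ltW.
  exists 2; apply: filterS hBc => k ck j; rewrite coef_gen; case: ifP => _; last first.
    by rewrite cmod0 mul0r.
  apply: mcoef_small; first by rewrite r00 ge_min lexx.
  have := ler_norm Bc; have := cmod_ge0 (c k); nra.
have [r1 [r10 r11] nS] : exists2 r1, 0 <= r1 /\ r1 < 1 & ~ bounded_family F G r1.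
  apply: contrapT => h; apply: (radius_lt1 unb) => r /andP[h0 h1].
  by apply: contrapT => nb; apply: h; exists r.
have ubS r : S r -> r <= r1.
  move=> [h0 hr]; rewrite leNgt; apply/negP => r1r; apply: nS.
  by apply: (bounded_familyW FU _ hr); rewrite r10 ltW.
have supS : has_sup S by split; [exists r0|exists r1].
pose R0 := sup S.
have R0r1 : R0 <= r1 by apply: ge_sup => //; exists r0.
have R00 : 0 < R0 by apply: lt_le_trans r00 _; apply: ub_le_sup => //; case: supS.
have R01 : R0 < 1 := le_lt_trans R0r1 r11.
(* The harmonic mean of [R0] and 1: larger than [R0], yet with square below [R0], so that [G(x^2)]
   is controlled at radius [rho1]. The radii [R0 < rho' < rho < rho1] are then equally spaced. *)
pose rho1 := 2 * R0 / (1 + R0).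
have rho1R : R0 < rho1 by rewrite /rho1 ltr_pdivlMr; nra.
have rho1sq : rho1 ^+ 2 < R0.
  have -> : rho1 ^+ 2 = R0 * (4 * R0 / (1 + R0) ^+ 2) by rewrite /rho1; field; lra.
  rewrite gtr_pMr // ltr_pdivrMr ?exprn_gt0 ?addr_gt0 // mul1r.
  have : 0 < (1 - R0) ^+ 2 by rewrite exprn_gt0 // subr_gt0.
  by rewrite !expr2; lra.
have [r [r_ge0 bG] rr] : exists2 r, S r & rho1 ^+ 2 < r.
  have [r Sr] := sup_adherent (ltac:(rewrite subr_gt0;
    exact: rho1sq) : 0 < R0 - rho1 ^+ 2) supS.
  by rewrite subKr => h; exists r.
have rR0 : r <= R0 by apply: ub_le_sup => //; case: supS.
have rle1 : r <= 1 by rewrite (le_trans rR0) // ltW.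
pose rho' := (2 * R0 + rho1) / 3; pose rho := (R0 + 2 * rho1) / 3.
have rho'0 : 0 < rho' by rewrite /rho'; lra.
have rho0 : 0 < rho by rewrite /rho; lra.
have rho'rho : rho' < rho by rewrite /rho' /rho; lra.
have rhorho1 : rho < rho1 by rewrite /rho; lra.
have R0rho' : R0 < rho' by rewrite /rho'; lra.
have rho10 : 0 < rho1 := lt_trans rho0 rhorho1.
have rho_sq : 0 <= rho ^+ 2 < r.
  by rewrite sqr_ge0 (lt_trans _ rr) // ltr_pXn2r ?nnegrE // ltW.
pose p k := take_poly (n k).+1 (G k * G k).
have pE : p = fun k => take_poly (n k).+1 (G k \Po 'X^2 - c k *: 'X).
  apply/funext => k; apply/polyP => j; rewrite !coef_take_poly; case: ifP => // jn.
  by rewrite (@gen_sqr _ _ _ (n k)) // ltnW // ltnS -addnn leq_addr.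
have bGc : bounded_family F (fun k => G k \Po 'X^2 - c k *: 'X) rho1.
  by apply: (bounded_family_gen_comp _ _ bG); rewrite ltW.
have bp : bounded_family F p rho1 by rewrite pE; exact: bounded_family_take.
have p0 k : (p k)`_0 = 1 by rewrite coef_take_poly /= coefM big_ord1 gen0 mulr1.
have pAA k : eq_upto (n k).+1 (G k * G k) (p k).
  by move=> j jn; rewrite coef_take_poly jn.
have root_lim x : root_seq F p rho x ->
    exists l, [/\ infsm F (fun k => x k - l), cmod l <= rho & psi_at l cs].
  move=> hx; have xb : \forall k \near F, cmod (x k) <= rho by apply: filterS hx => k [].
  have [l hl] : exists l, infsm F (fun k => x k - l) by apply: bounded_lim => //; exists rho.
  have lb : cmod l <= rho := lim_bound FU hl xb.
  have rr1 : 0 <= rho < rho1 by rewrite ltW.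
  exists l; split => //.
  have h1 := horner_equicontinuous FU rr1 bp xb (near_all FU (fun=> lb)) hl.
  have bd : bounded_family F (fun k => (G k \Po 'X^2 - c k *: 'X) - p k) rho1.
    by apply: bounded_familyB => //; exact: ltW.
  have h2 := horner_infsm FU rr1 bd (near_all FU (fun=> lb)).
  have {}h2 : infsm F (fun k => ((G k \Po 'X^2 - c k *: 'X) - p k).[l]).
    apply: h2 => j; apply: infsm_eq (infsm0 FU); apply: filterS (noo j) => k jk.
    by rewrite pE coefB coef_take_poly ltnS jk subrr.
  have h3 := infsmMl FU (bounded_cst FU l) c_lim.
  apply: infsm_eq (infsmD FU (infsmB FU h2 h1) h3).
  apply: filterS hx => k [_ /rootP ->].
  by rewrite !(hornerE, horner_comp); ring.
have rho01 : 0 < rho' < rho by rewrite rho'0.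
have H := near_coef_neq0 FU rho01 rhorho1 noo bp p0 (fun k => gen0 (c k) (n k)) pAA.
have {}H : \forall k \near F, (G k)`_(n k) != 0; last first.
  by apply: filterS H => k; rewrite coef_gen leqnn.
apply: H.
- apply: (near_contra FU) => bad.
  (* Without zeros in [|x| <= rho'], the square root estimate would bound [G] at a radius above the
     supremum [R0]. *)
  suff : rho' <= R0 by rewrite leNgt R0rho'.
  apply: ub_le_sup; first by case: supS.
  split; first exact: ltW.
  have [B hB] := bp; have q01 : 0 <= rho' / rho1 < 1.
    by rewrite divr_ge0 ?ltW //= ltr_pdivrMr // mul1r (lt_trans rho'rho).
  exists (Num.sqrt (2 * (B * (1 - rho' / rho1)^-1))).
  apply: filterS2 hB bad => k hk /forallNP nr j.
  have [jn|nj] := ltnP j (n k).+1; last first.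
    by rewrite coef_gen leqNgt nj /= cmod0 mul0r sqrtr_ge0.
  apply: (sqrt_coef_estimate rho'0 (p0 k) _ _ (gen0 _ _) (pAA k) jn) => x hx.
    by apply/negP => hr; exact: (nr x).
  by apply: (horner_bound rho10 q01 hk); rewrite divfK // gt_eqF.
- move=> x y /root_lim [l [xl lb pl]] /root_lim [l' [yl lb' pl']].
  have ll : l = l'.
    by apply: (psi_at_inj rho_sq rle1 bG orb _ _ pl pl');
      rewrite cmodX lerXn2r // nnegrE ?cmod_ge0 // ltW.
  by apply: infsm_eq (infsmB FU xl yl); apply: nearW => k; rewrite ll; ring.
- move=> x hx hd; have [l [xl lb pl]] := root_lim x hx.
  have xb : \forall k \near F, cmod (x k) <= rho by apply: filterS hx => k [].
  have l2 : cmod (l ^+ 2) <= rho ^+ 2 by rewrite cmodX lerXn2r // nnegrE ?cmod_ge0 // ltW.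
  apply: (V_not_infsm rho_sq rle1 bG l2).
  pose rm := (rho + rho1) / 2.
  have rm1 : 0 <= rm < rho1 by apply/andP; rewrite /rm; split; lra.
  have rm2 : 0 <= rho < rm by apply/andP; rewrite /rm; split; lra.
  have rm0 : 0 <= rm by case/andP: rm1.
  have rmr : rm ^+ 2 <= (rho1 ^+ 2 + r) / 2.
    have : rm ^+ 2 <= rho1 ^+ 2.
      by rewrite lerXn2r ?nnegrE // ltW //; case/andP: rm1.
    by move: rr; lra.
  have rV : 0 <= (rho1 ^+ 2 + r) / 2 < r.
    by have := sqr_ge0 rho1; move: rr => ? ?; apply/andP; split; lra.
  (* Up to truncation [W] is [V(x^2)], and at a zero of [p] it equals [x p'(x)]. So a degenerate
     zero would give a zero of [V] at [l^2]. *)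
  pose W k := 'X * (p k)^`() - p k.
  have bW : bounded_family F W rm.
    apply: bounded_familyB => //; first exact: (bounded_familyXderiv FU rm1 bp).
    by apply: (bounded_familyW FU _ bp); rewrite rm0 ltW //; case/andP: rm1.
  have h1 : infsm F (fun k => (W k).[x k]).
    apply: infsm_eq hd; apply: filterS hx => k [_ /rootP h].
    by rewrite /W !hornerE h subr0.
  have h2 := horner_equicontinuous FU rm2 bW xb (near_all FU (fun=> lb)) xl.
  have bd : bounded_family F (fun k => (V k \Po 'X^2) - W k) rm.
    apply: bounded_familyB => //.
    exact: (bounded_family_comp FU rm0 rmr (bounded_V rV bG)).
  have h3 : infsm F (fun k => ((V k \Po 'X^2) - W k).[l]).
    apply: (horner_infsm FU rm2 bd (near_all FU (fun=> lb))) => j.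
    apply: infsm_eq (infsm0 FU); apply: filterS (noo j) => k jk.
    rewrite coefB coefV_comp; have -> : (W k)`_j = (j%:R - 1) * (p k)`_j.
      by rewrite /W coefB coefXderiv -(mulr_natl (p k)`_j); ring.
    by rewrite pE coef_take_poly ltnS jk subrr.
  apply: infsm_eq (infsmD FU h3 (infsmB FU h1 h2)); apply: nearW => k.
  by rewrite hornerD hornerN horner_comp hornerXn; ring.
Qed.

End BoundedParameters.

(** * Parameters tending to infinity *)

Section UnboundedParameters.
Variables (R : realType) (F : set_system nat).
Hypothesis FU : UltraFilter F.
Local Notation C := R[i].

Let PF : ProperFilter F. Proof. exact: ultra_proper. Qed.
Local Existing Instance PF.

(* In the variable [w = c x] the functional equation becomes
   [G^2 = G(w^2 / c^2) - w], whose right-hand side tends to [1 - w]. *)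
Lemma near_mcoef_neq0_unbounded (c : nat -> C) (n : nat -> nat) :
  (forall m, \forall k \near F, (m <= n k)%N) ->
  (forall K : R, \forall k \near F, K < cmod (c k)) ->
  \forall k \near F, mcoef (c k) (n k) != 0.
Proof.
move=> noo c_oo.
pose A k : {poly C} := \poly_(i < (n k).+1) (mcoef (c k) i / c k ^+ i).
pose p k := take_poly (n k).+1 (A k * A k).
have c0 : \forall k \near F, c k != 0.
  by apply: filterS (c_oo 0) => k; rewrite cmod_gt0.
have A0 k : (A k)`_0 = 1 by rewrite coef_poly /= /mcoef /= expr0 divr1.
have p0 k : (p k)`_0 = 1 by rewrite coef_take_poly /= coefM big_ord1 A0 mulr1.
have pAA k : eq_upto (n k).+1 (A k * A k) (p k).
  by move=> j jn; rewrite coef_take_poly jn.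
have coefp k j : c k != 0 -> (j <= n k)%N -> (p k)`_j =
    (if odd j then 0 else mcoef (c k) j./2 / c k ^+ j) - (if j == 1%N then 1 else 0).
  move=> ck jn; rewrite coef_take_poly ltnS jn.
  have gs := @gen_sqr _ (c k) (n k) (n k) (ltac:(by rewrite ltnW // ltnS -addnn leq_addr)) j jn.
  have -> : (A k * A k)`_j = (gen_poly (c k) (n k) * gen_poly (c k) (n k))`_j / c k ^+ j.
    rewrite !coefM mulr_suml; apply: eq_bigr => i _.
    have ij : (i <= j)%N by rewrite -ltnS.
    have e1 : (i <= n k)%N := leq_trans ij jn.
    have e2 : (j - i <= n k)%N := leq_trans (leq_subr _ _) jn.
    rewrite !coef_gen !coef_poly !ltnS e1 e2.
    have -> : c k ^+ j = c k ^+ i * c k ^+ (j - i) by rewrite -exprD subnKC.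
    by field; rewrite !expf_neq0.
  rewrite gs coefB coef_comp_poly_Xn // coefZ coefX dvdn2 divn2 coef_gen if_neg mulrBl.
  have -> : (j./2 <= n k)%N by rewrite (leq_trans _ jn) // -[leqRHS]odd_double_half -addnn
    addnA leq_addl.
  congr (_ - _); first by case: ifP => // _; rewrite mul0r.
  by case: eqP => [->|_]; rewrite ?expr1 ?mulr1 ?mulfV // mulr0 mul0r.
pose dev k := p k - (1 - 'X).
(* By [mcoef_small] at radius [1 / (4 |c|)], the coefficient of degree [2 i] in [p] is at most
   [2 (4 / |c|)^i]. The two thresholds on [|c|] make the first such term small and the others decay
   at radius [r]. *)
have dev_small (r e : R) : 1 <= r -> 0 < e -> \forall k \near F, coef_bound (dev k) r e.
  move=> r1 e0; have rp : 0 < r by apply: lt_le_trans r1.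
  have r2 : 0 < r ^+ 2 by exact: exprn_gt0.
  apply: filterS3 (noo 1%N) (c_oo (4 + 4 * r ^+ 2)) (c_oo (8 * r ^+ 2 / e)) => k nk ck4 cke.
  have cp : 0 < cmod (c k) by apply: lt_trans ck4; lra.
  have ck : c k != 0 by rewrite -cmod_gt0.
  have small := @mcoef_small R (c k) (4 * cmod (c k))^-1.
  have h1 : 0 < (4 * cmod (c k))^-1 <= 16^-1.
    rewrite invr_gt0 mulr_gt0 //= lef_pV2 ?posrE ?mulr_gt0 //; lra.
  have h2 : cmod (c k) * (4 * cmod (c k))^-1 <= 4^-1.
    by rewrite invfM mulrCA mulfV ?mulr1 // gt_eqF.
  have {}small := small h1 h2.
  move=> j; rewrite /dev !coefB coef1 coefX.
  have [jn|nj] := leqP j (n k); last first.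
    rewrite coef_take_poly ltnS leqNgt nj /=.
    case: j nj => [|[|j]] nj; rewrite ?ltn0 // in nj *; first by rewrite leqNgt nj in nk.
    by rewrite !subr0 cmod0 mul0r ltW.
  rewrite coefp //; case: j jn => [|[|j]] jn /=.
  - by rewrite /mcoef /= expr0 divr1 !subr0 subrr cmod0 mul0r ltW.
  - by rewrite !sub0r subrr cmod0 mul0r ltW.
  case: ifP => oj; first by rewrite !subr0 cmod0 mul0r ltW.
  rewrite !subr0; have oj2 : odd j = false by move: oj; rewrite /= negbK.
  have Dj : j.+2 = (j./2.+1 + j./2.+1)%N.
    by rewrite addnn doubleS -[in LHS](odd_double_half j) oj2.
  move: (j./2) Dj => i Dj; rewrite Dj; set M := cmod (c k) in cp ck4 cke h1 h2 small *.
  have := small i.+1; rewrite exprVn ler_pdivrMr ?exprn_gt0 ?mulr_gt0 // => hs.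
  rewrite cmodM cmodV cmodX -/M mulrAC ler_pdivrMr ?exprn_gt0 //.
  apply: le_trans (ler_wpM2r _ hs) _; first by rewrite exprn_ge0 // ltW.
  have -> : 2 * (4 * M) ^+ i.+1 * r ^+ (i.+1 + i.+1) = (8 * r ^+ 2) * M * (4 * r ^+ 2 * M) ^+ i.
    rewrite addnn -mul2n exprM; move: (r ^+ 2) => s.
    by rewrite !exprMn !exprS; ring.
  have -> : e * M ^+ (i.+1 + i.+1) = (e * M) * M * (M * M) ^+ i.
    by rewrite exprD exprMn !exprS; ring.
  apply: ler_pM; rewrite ?mulr_ge0 ?exprn_ge0 ?mulr_ge0 ?(ltW cp) ?(ltW rp) ?(ltW r2) //.
    by rewrite (ler_pM2r cp) [leRHS]mulrC -ler_pdivrMr // ltW.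
  rewrite lerXn2r ?nnegrE ?mulr_ge0 ?(ltW cp) ?(ltW r2) ?(ltW rp) // ler_pM2r //.
  by rewrite (le_trans _ (ltW ck4)) // lerDr.
(* The zero is near 1, but its existence proof needs a large disk: on [|x| <= 20] one has
   [|p| <= 22], and the linear coefficient [-1/2] of [A] weighs [10 > sqrt 44] there. The radii 21
   and 22 leave room around it. *)
have r22 : 1 <= (22 : R) by rewrite ler1n.
have b1X : bounded_family F (fun=> 1 - 'X : {poly C}) 22.
  apply: bounded_familyB => //.
    by exists (cmod (1 : C)); apply: nearW => k; apply: coef_boundC.
  have := bounded_familyZX FU (ler0n R 22) (bounded_cst FU (1 : C)).
  by move=> [B hB]; exists B; apply: filterS hB => k; rewrite scale1r.
have bdev : bounded_family F dev 22 by exists 1; exact: dev_small.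
have bp : bounded_family F p 22.
  have [B hB] := bounded_familyD FU (ler0n R 22) bdev b1X; exists B.
  by apply: filterS hB => k; rewrite /dev subrK.
have dev0 j : infsm F (fun k => (dev k)`_j).
  move=> e e0; have e2 : 0 < e / 2 by rewrite divr_gt0.
  apply: filterS (dev_small 1 _ (lexx 1) e2) => k /(_ j).
  rewrite expr1n mulr1 => h; apply: le_lt_trans h _.
  by rewrite ltr_pdivrMr // ltr_pMr // ltr1n.
have s21 : 0 <= (21 : R) < 22 by rewrite ler0n ltr_nat.
have root_lim x : root_seq F p 21 x -> infsm F (fun k => x k - 1).
  move=> hx; have xb : \forall k \near F, cmod (x k) <= 21 by apply: filterS hx => k [].
  have h := horner_infsm FU s21 bdev xb dev0.
  apply: infsm_eq h; apply: filterS hx => k [_ /rootP h].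
  by rewrite /dev hornerD hornerN h hornerD hornerC hornerN hornerX; ring.
have r01 : 0 < (20 : R) < 21 by rewrite ltr0n ltr_nat.
have r12 : (21 : R) < 22 by rewrite ltr_nat.
have H := near_coef_neq0 FU r01 r12 noo bp p0 A0 pAA.
have {}H : \forall k \near F, (A k)`_(n k) != 0; last first.
  apply: filterS H => k; rewrite coef_poly ltnSn mulf_eq0 negb_or.
  by case/andP.
apply: H.
- apply: (near_contra FU) => bad.
  have q01 : 0 <= (20 / 21 : R) < 1 by apply/andP; split; lra.
  have e1 : 0 < (1 / 21 : R) by lra.
  have h : \forall k \near F, [/\ coef_bound (dev k) 21 (1 / 21), ~ (exists x,
    cmod x <= 20 /\ root (p k) x), (1 < (n k).+1)%N & c k != 0].
    near=> k; split; near: k => //.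
    + by apply: dev_small => //; rewrite ler1n.
    + exact: (noo 1%N).
  have /filter_ex [k [hk /forallNP nr nk ck]] := h.
  have pB x : cmod x <= 20 -> cmod (p k).[x] <= 22.
    move=> hx; have -> : (p k).[x] = (dev k).[x] + (1 - x).
      by rewrite /dev hornerD hornerN hornerD hornerC hornerN hornerX subrK.
    have h1 : cmod (dev k).[x] <= (1 / 21) * (1 - 20 / 21)^-1.
      by apply: (horner_bound _ q01 hk); rewrite ?ltr0n //; lra.
    have h2 : (1 / 21) * (1 - 20 / 21)^-1 = 1 :> R by field.
    apply: le_trans (ler_cmodD _ _) _; have := ler_cmodB 1 x.
    by rewrite cmod1; lra.
  have nr' x : cmod x <= 20 -> ~~ root (p k) x.
    by move=> hx; apply/negP => hr; exact: (nr x).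
  have := sqrt_coef_estimate (ltr0n R 20) (p0 k) nr' pB (A0 k) (pAA k) nk.
  have -> : (A k)`_1 = - 2^-1.
    rewrite coef_poly nk /mcoef /= map_polyX hornerX expr1.
    by field.
  rewrite cmodN cmodV cmodn expr1 => h3.
  have : (10 : R) ^+ 2 <= Num.sqrt (2 * 22) ^+ 2.
    by rewrite lerXn2r ?nnegrE ?sqrtr_ge0 //; lra.
  by rewrite sqr_sqrtr ?mulr_ge0 // -natrX -natrM ler_nat.
- move=> x y /root_lim hx /root_lim hy.
  by apply: infsm_eq (infsmB FU hx hy); apply: nearW => k; ring.
- move=> x hx hd; have xb : \forall k \near F, cmod (x k) <= 21 by apply: filterS hx => k [].
  have m1 : 0 <= (43 / 2 : R) < 22 by apply/andP; split; lra.
  have m2 : 0 <= (21 : R) < 43 / 2 by apply/andP; split; lra.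
  have bE := bounded_familyXderiv FU m1 bdev.
  have hE : infsm F (fun k => ('X * (dev k)^`()).[x k]).
    apply: (horner_infsm FU m2 bE xb) => j.
    apply: infsm_eq (infsmMl FU (bounded_cst FU (j%:R : C)) (dev0 j)).
    by apply: nearW => k; rewrite coefXderiv mulr_natl.
  have hx1 := root_lim x hx.
  (* At a zero, [x p'(x) = x dev'(x) - x] tends to [-1]; were it infinitesimal, so would be the
     constant 1. *)
  suff /(infsm_cst FU)/eqP : infsm F (fun=> 1 : C) by rewrite oner_eq0.
  apply: infsm_eq (infsmB FU (infsmB FU hE hd) hx1); apply: nearW => k.
  rewrite /dev derivB derivB derivX derivC sub0r opprK !hornerE.
  by ring.
Unshelve. all: by end_near. Qed.

End UnboundedParameters.

(** * From neighbourhoods of the Mandelbrot set to sequences of parameters *)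

Section BoundedOrbits.
Variable R : realType.
Local Notation C := R[i].

Lemma not_mandelbrot_unbounded (c : C) : ~ mandelbrot_set R c ->
  forall K : R, exists m, K <= cmod (iter m (fun z => z ^+ 2 + c) 0).
Proof.
move=> nM K; apply: contrapT => h; apply: nM.
exists K%:C%C; split.
  by rewrite realE -[0]/(0%:C%C) !lecR -realE num_real.
move=> x Kx m _; have hm : cmod (iter m (fun z => z ^+ 2 + c) 0) <= K.
  by rewrite leNgt; apply/negP => /ltW h1; apply: h; exists m.
apply: le_trans (ltW Kx) => /=.
have -> : `|mandelbrot_orbit c m| = (cmod (iter m (fun z =>
  z ^+ 2 + c) 0))%:C%C by exact: normCE.
by rewrite lecR.
Qed.

Lemma open_ball (U : set R[i]^o) (c : C) : open U -> U c ->
  exists2 e : R, 0 < e & forall z : C, cmod (z - c) < e -> U z.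
Proof.
move=> oU Uc; have /nbhs_ballP [e e0 he] := open_nbhs_nbhs (conj oU Uc).
have [er De] : exists er : R, e = er%:C%C.
  by exists (complex.Re e); rewrite -[LHS]RRe_real // gtr0_real.
exists er; first by move: e0 => /=; rewrite De -[0]/(0%:C%C) ltcR.
move=> z zc; apply: he; rewrite -ball_normE /= normCE De ltcR.
by rewrite cmodBC.
Qed.

End BoundedOrbits.

Theorem theorem6p14 (R : realType) (U : set R[i]^o) :
  open U -> mandelbrot_set R `<=` U ->
  exists N : nat, forall n : nat, (N < n)%N ->
    forall c : R[i], c \notin U ->
      (map_poly ratr (mandelbrot_poly n)).[- c / 2] != 0.
Proof.
move=> oU MU; apply: contrapT => /forallNP H.
have /choice [w hw] : forall k : nat, exists w : nat * R[i],
    [/\ (k < w.1)%N, ~ U w.2 & mcoef w.2 w.1 = 0].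
  move=> k; have /existsNP [n /not_implyP [kn /existsNP [c /not_implyP [cU h]]]] := H k.
  exists (n, c); split => //=; first by move/negP: cU => cU Uc; apply: cU; rewrite inE.
  rewrite /mcoef (gtn_eqF (leq_ltn_trans _ kn)) //.
  by apply/eqP; apply: contrapT => /negP.
pose n k := (w k).1; pose c k := (w k).2.
have [F [FU oF]] := ultraFilterLemma eventually_filter.
have PF : ProperFilter F by exact: ultra_proper.
have noo m : \forall k \near F, (m <= n k)%N.
  apply: oF; exists m => // k /= mk.
  by have [h _ _] := hw k; rewrite (leq_trans mk) // ltnW.
suff /filter_ex [k] : \forall k \near F, mcoef (c k) (n k) != 0.
  by have [_ _ ->] := hw k; rewrite eqxx.
(* If the parameters are bounded near [F], their limit lies outside the Mandelbrot set: otherwise it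
   would lie in the open set [U], and so would some [c k]. If not, the ultrafilter property makes
   [|c k|] exceed every bound near [F]. *)
have [[K hK]|unb] := pselect (exists K : R, \forall k \near F, cmod (c k) <= K).
  have [cs c_lim] : exists cs, infsm F (fun k => c k - cs) by apply: bounded_lim => //;
    exists K.
  apply: (near_mcoef_neq0_bounded FU noo c_lim).
  apply: not_mandelbrot_unbounded => /MU Ucs.
  have [e e0 he] := open_ball oU Ucs.
  have /filter_ex [k ck] := c_lim e e0.
  by have [_ nU _] := hw k; apply: nU; exact: he.
apply: (near_mcoef_neq0_unbounded FU noo) => K.
apply: (near_contra FU) => h; apply: unb; exists K.
by apply: filterS h => k /negP; rewrite -leNgt.
Qed.
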